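(* Let $\mathfrak A$ be a convenient algebra, and let $\omega$ be a connection type. (a) Assume $A=(A_1,\ldots,A_n)\in\mathfrak A^n$, $Q=(Q_1,\ldots,Q_n)$ is a Clifford system in $\mathfrak A$, and $A-Q\in(\mathfrak A^{(1)})^n$. Consider $Q^{[k]}=(\mathrm{Step}^\omega_A)^kQ$, where $\mathrm{Step}^\omega_A\,Q'=(\mathrm{Ad}\exp\Pi^\omega_{Q'}(A-Q'))Q'$. Then $Q^{[\omega]}=\lim_{k\to\infty}Q^{[k]}$ exists; in fact $$Q^{[k]}-Q^{[\omega]}\in(\mathfrak A^{(k+1)})^n;$$ furthermore $Q^{[\omega]}$ is a Clifford system. Moreover, it is the only Clifford system $\widetilde Q$ in $\mathfrak A$ such that $\Pi^\omega_{\widetilde Q}A=0$ and $A-\widetilde Q\in(\mathfrak A^{(1)})^n$ hold. (b) Correspondingly, assume $A\in\mathfrak A^n$, $Q$ is a floating Clifford system in $\mathfrak A$, and $A-Q\in(\mathfrak A^{(1)})^n$. Consider $Q^{[k]}=(\mathrm{Step}^{\mathrm f\omega}_A)^kQ$, where $\mathrm{Step}^{\mathrm f\omega}_A\,Q'=(\mathrm{Ad}^{\mathrm f}\exp^{\mathrm f}\Pi^{\mathrm f\omega}_{Q'}(A-Q'))Q'$. Then $Q^{[\mathrm f\omega]}=\lim_{k\to\infty}Q^{[k]}$ exists, $Q^{[k]}-Q^{[\mathrm f\omega]}\in(\mathfrak A^{(k+1)})^n$, $Q^{[\mathrm f\omega]}$ is a floating Clifford system, and it is the only floating Clifford system $\widetilde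 Q$ in $\mathfrak A$ such that $\Pi^{\mathrm f\omega}_{\widetilde Q}A=\frac12\,1^{\mathrm f}$ and $A-\widetilde Q\in(\mathfrak A^{(1)})^n$ hold.
   Context: Convenient algebra: a unital real algebra $\mathfrak A$ with a decreasing filtration $\mathfrak A=\mathfrak A^{(0)}\supset\mathfrak A^{(1)}\supset\cdots$, $\mathfrak A^{(i)}\mathfrak A^{(j)}\subset\mathfrak A^{(i+j)}$, complete and Hausdorff for the filtration, with all $\mathfrak A/\mathfrak A^{(i)}$ finite-dimensional. Convergence means convergence in every $\mathfrak A/\mathfrak A^{(i)}$. Clifford system: $(Q_1,\ldots,Q_n)$ with $Q_iQ_j+Q_jQ_i=-2\delta_{ij}1$. Floating Clifford system: $(Q_1,\ldots,Q_n)$ with $(Q_2Q_1^{-1},\ldots,Q_nQ_1^{-1})$ a Clifford system. For $Q^2=\pm1$: $R^0_Q=\frac12(R+Q^{-1}RQ)$, $R^1_Q=\frac12(R-Q^{-1}RQ)$; iterated as $R^{\iota_1}_{Q_1}{}^{\iota_2}_{Q_2}\cdots$. For a Clifford system $Q$, $\iota\in\{0,1\}^n$: $(R/Q)^\iota_j=(R_jQ_j^{-1}){}^{\iota_1}_{Q_1}\cdots{}^{\iota_n}_{Q_n}$. For a floating Clifford system $Q$ (any choice of $k$; differences modulo $2$; the result is independent of $k$): $$(R/Q)^{\mathrm f\iota}_j=(R_jQ_j^{-1}){}^{\iota_1-\iota_k}_{Q_1Q_k^{-1}}\cdots{}^{\iota_n-\iota_k}_{Q_nQ_k^{-1}},\qquad(Q\backslash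 R)^{\mathrm f\iota}_j=(Q_j^{-1}R_j){}^{\iota_1-\iota_k}_{Q_k^{-1}Q_1}\cdots{}^{\iota_n-\iota_k}_{Q_k^{-1}Q_n}.$$ $\mathfrak A^{\mathrm f}=\mathfrak A\times\mathfrak A^{\mathrm{opp}}$, $1^{\mathrm f}=(1,1^{\mathrm{opp}})$, $\exp^{\mathrm f}$ its exponential. $(\mathrm{Ad}\,X)A=(XA_1X^{-1},\ldots,XA_nX^{-1})$ and $(\mathrm{Ad}^{\mathrm f}(X,Y^{\mathrm{opp}}))A=(XA_1Y,\ldots,XA_nY)$ for units. Tangent spaces: $T_Q=\{X\in\mathfrak A: X{}^0_{Q_1}\cdots{}^0_{Q_n}=0\}$ for a Clifford system $Q$; $T^{\mathrm f}_Q=\{(X,Y^{\mathrm{opp}})\in\mathfrak A^{\mathrm f}:(X-Q_kYQ_k^{-1}){}^0_{Q_1Q_k^{-1}}\cdots{}^0_{Q_nQ_k^{-1}}=0\}$ for a floating one (independent of $k$). A connection type $\omega$ is one of the following, giving linear maps $\Pi^\omega_Q:\mathfrak A^n\to T_Q$ and $\Pi^{\mathrm f\omega}_Q:\mathfrak A^n\to T^{\mathrm f}_Q$. (1) Real numbers $\omega^\iota_j$ ($j\in\{1,\ldots,n\}$, $\iota\in\{0,1\}^n$) with $\omega^\iota_j=0$ if $\iota_j=0$, and $\sum_j\omega^\iota_j=1$ if $\iota\ne(0,\ldots,0)$. Then $\Pi^\omega_QR=\frac12\sum_{j,\iota}\omega^\iota_j(R/Q)^\iota_j$ and $\Pi^{\mathrm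 f\omega}_QR=\bigl(\frac12\sum_{j,\iota}\omega^\iota_j(R/Q)^{\mathrm f\iota}_j,\ (\frac12\sum_{j,\iota}\omega^\iota_j(Q\backslash R)^{\mathrm f\iota}_j)^{\mathrm{opp}}\bigr)$. (Examples: GS: $\omega^\iota_j=1$ if $j=\min\{h:\iota_h=1\}$ and $0$ otherwise; Sy: $\omega^\iota_j=\iota_j/(\iota_1+\cdots+\iota_n)$.) (2) A positive definite real $n\times n$ matrix $\eta=[\eta^{ij}]$. Then $\Pi^\eta_QR=(M_{\eta,Q})^{-1}\bigl(\sum_{i,j}\eta^{ij}[R_j,Q_i]\bigr)$, where $M_{\eta,Q}:T_Q\to T_Q$, $X\mapsto\sum_{i,j}\eta^{ij}[[X,Q_j],Q_i]$; and $\Pi^{\mathrm f\eta}_QR=(M^{\mathrm f}_{\eta,Q})^{-1}\bigl(\sum_{i,j}\eta^{ij}(R_jQ_i^{-1},(Q_i^{-1}R_j)^{\mathrm{opp}})\bigr)$, where $M^{\mathrm f}_{\eta,Q}:T^{\mathrm f}_Q\to T^{\mathrm f}_Q$, $(X,Y^{\mathrm{opp}})\mapsto\sum_{i,j}\eta^{ij}\bigl((XQ_j+Q_jY)Q_i^{-1},(Q_i^{-1}(XQ_j+Q_jY))^{\mathrm{opp}}\bigr)$. (3) A limit of connections of kind (2) along a sequence of positive definite matrices whose connection data converge. *)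

(* Defs.v *)
From HB Require Import structures.
From mathcomp Require Import all_boot all_order all_algebra.
From mathcomp Require Import all_classical all_reals all_analysis.
Set Implicit Arguments.
Unset Strict Implicit.
Unset Printing Implicit Defensive.
Import Order.TTheory GRing.Theory Num.Theory.
Import numFieldNormedType.Exports.
Local Open Scope classical_set_scope.
Local Open Scope ring_scope.

(* The opposite algebra: MathComp's [A^c] carries the opposite ring; here it
   receives the scaling of A. *)
HB.instance Definition _ (K : pzRingType) (A : lmodType K) :=
  GRing.Lmodule.copy A^c A.

Section ConverseAlgebra.
Variables (K : comPzRingType) (A : algType K).

Lemma conv_scalerAl (a : K) (u v : A^c) :
  a *: (u * v : A^c) = (a *: u : A^c) * v :> A^c.
Proof. exact: (@scalerAr K A a v u). Qed.

HB.instance Definition _ :=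
  GRing.LSemiModule_isLSemiAlgebra.Build K A^c conv_scalerAl.

Lemma conv_scalerAr (a : K) (u v : A^c) :
  a *: (u * v : A^c) = u * (a *: v : A^c) :> A^c.
Proof. exact: (@scalerAl K A a v u). Qed.

HB.instance Definition _ :=
  GRing.LSemiAlgebra_isSemiAlgebra.Build K A^c conv_scalerAr.

End ConverseAlgebra.

Section Convergence.
Variables (R : realType) (V : lmodType R).

(* p identifies the quotient of V by the subspace U with R^d. *)
Definition quotient_coordinates (U : set V) (d : nat)
    (p : {linear V -> 'rV[R]_d}) : Prop :=
  range p = setT /\ forall x, p x = 0 <-> U x.

(* Convergence in every quotient V / F i for its topology of finite-dimensional
   real vector space, read in (any) coordinates. *)
Definition converges (F : nat -> set V) (u : nat -> V) (l : V) : Prop :=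
  forall (i d : nat) (p : {linear V -> 'rV[R]_d}),
    quotient_coordinates (F i) p -> (fun m => p (u m)) @ \oo --> p l.

(* 0 when there is no limit. *)
Definition flim (F : nat -> set V) (u : nat -> V) : V :=
  xget 0 [set l | converges F u l].

End Convergence.

Section Algebra.
Variables (R : realType).

Record convenient (A : algType R) (F : nat -> set A) : Prop := Convenient {
  filtration0 : F 0%N = setT;
  filtration_mem0 : forall i, F i 0;
  filtration_linear : forall i (a : R) x y,
    F i x -> F i y -> F i (a *: x + y);
  filtration_decr : forall i, F i.+1 `<=` F i;
  filtration_mul : forall i j x y, F i x -> F j y -> F (i + j)%N (x * y);
  filtration_hausdorff : \bigcap_i F i = [set 0];
  filtration_complete : forall u : nat -> A,
    (forall i, exists N, forall k l,
      (N <= k)%N -> (N <= l)%N -> F i (u k - u l)) ->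
    exists x, forall i, exists N, forall k, (N <= k)%N -> F i (u k - x);
  filtration_findim : forall i, exists d (p : {linear A -> 'rV[R]_d}),
    quotient_coordinates (F i) p }.

Definition fexp (A : algType R) (F : nat -> set A) (X : A) : A :=
  flim F (series (fun m => (m`!%:R : R)^-1 *: X ^+ m)).

Variables (A : unitAlgType R).

Definition clifford n (Q : 'I_n -> A) : Prop :=
  forall i j, Q i * Q j + Q j * Q i = - 2 * (i == j)%:R.

Definition floating_clifford n (Q : 'I_n.+1 -> A) : Prop :=
  Q ord0 \is a GRing.unit /\
  clifford (fun i : 'I_n => Q (lift ord0 i) / Q ord0).

(* R^0_Q (b = false) and R^1_Q (b = true). *)
Definition part (b : bool) (Q X : A) : A :=
  2^-1 *: (if b then X - Q^-1 * X * Q else X + Q^-1 * X * Q).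

(* X ^{iota_1}_{Q_1} ... ^{iota_n}_{Q_n}, the index 1 being applied first. *)
Definition parts n (iota : 'I_n -> bool) (Q : 'I_n -> A) (X : A) : A :=
  foldl (fun Y i => part (iota i) (Q i) Y) X (enum 'I_n).

Definition commutator (X Y : A) : A := X * Y - Y * X.

Definition doubled : algType R := (A * A^c)%type.

Definition doubled_pair (X Y : A) : doubled := (X, Y).

Definition doubled_filtration (F : nat -> set A) : nat -> set doubled :=
  fun i => [set Z | F i Z.1 /\ F i Z.2].

Definition Ad n (X : A) (B : 'I_n -> A) : 'I_n -> A :=
  fun i => X * B i * X^-1.

Definition fAd n (Z : doubled) (B : 'I_n -> A) : 'I_n -> A :=
  fun i => Z.1 * B i * (Z.2 : A).

Definition tangent n (Q : 'I_n -> A) : set A :=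
  [set X | parts (fun=> false) Q X = 0].

(* In the floating notions k is the auxiliary index, on which nothing depends
   when Q is a floating Clifford system. *)
Definition ftangent n (k : 'I_n) (Q : 'I_n -> A) : set doubled :=
  [set Z | parts (fun=> false) (fun i => Q i / Q k)
             (Z.1 - Q k * (Z.2 : A) / Q k) = 0].

Inductive connection (n : nat) : Type :=
| Coefficients of ('I_n -> {ffun 'I_n -> bool} -> R)
| Metric of 'M[R]_n
| MetricLimit of (nat -> 'M[R]_n).

Section Projections.
Variables (F : nat -> set A) (n : nat) (k : 'I_n).
Implicit Types (Q B : 'I_n -> A) (eta : 'M[R]_n).
Implicit Types (w : 'I_n -> {ffun 'I_n -> bool} -> R).

Definition Pi_coef w Q B : A :=
  2^-1 *: \sum_j \sum_(iota : {ffun 'I_n -> bool})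
    w j iota *: parts iota Q (B j / Q j).

Definition fPi_coef w Q B : doubled :=
  doubled_pair
    (2^-1 *: \sum_j \sum_(iota : {ffun 'I_n -> bool})
      w j iota *: parts (fun i => iota i (+) iota k)
                    (fun i => Q i / Q k) (B j / Q j))
    (2^-1 *: \sum_j \sum_(iota : {ffun 'I_n -> bool})
      w j iota *: parts (fun i => iota i (+) iota k)
                    (fun i => (Q k)^-1 * Q i) ((Q j)^-1 * B j)).

Definition M_metric eta Q (X : A) : A :=
  \sum_i \sum_j eta i j *: commutator (commutator X (Q j)) (Q i).

Definition Pi_metric eta Q B : A :=
  'pinv_(fun=> 0) (tangent Q) (M_metric eta Q)
    (\sum_i \sum_j eta i j *: commutator (B j) (Q i)).

Definition fM_metric eta Q (Z : doubled) : doubled :=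
  \sum_i \sum_j eta i j *:
    let W := Z.1 * Q j + Q j * (Z.2 : A) in
    doubled_pair (W / Q i) ((Q i)^-1 * W).

Definition fPi_metric eta Q B : doubled :=
  'pinv_(fun=> 0) (ftangent k Q) (fM_metric eta Q)
    (\sum_i \sum_j eta i j *: doubled_pair (B j / Q i) ((Q i)^-1 * B j)).

Definition Pi (omega : connection n) Q B : A :=
  match omega with
  | Coefficients w => Pi_coef w Q B
  | Metric eta => Pi_metric eta Q B
  | MetricLimit eta => flim F (fun m => Pi_metric (eta m) Q B)
  end.

Definition fPi (omega : connection n) Q B : doubled :=
  match omega with
  | Coefficients w => fPi_coef w Q B
  | Metric eta => fPi_metric eta Q B
  | MetricLimit eta =>
      flim (doubled_filtration F) (fun m => fPi_metric (eta m) Q B)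
  end.

Definition Step (omega : connection n) B Q : 'I_n -> A :=
  Ad (fexp F (Pi omega Q (fun j => B j - Q j))) Q.

Definition fStep (omega : connection n) B Q : 'I_n -> A :=
  fAd (fexp (doubled_filtration F) (fPi omega Q (fun j => B j - Q j))) Q.

End Projections.

Definition positive_definite n (eta : 'M[R]_n) : Prop :=
  eta^T = eta /\ forall v : 'rV[R]_n, v != 0 -> 0 < (v *m eta *m v^T) 0 0.

(* For a limit, the connection data are the maps Pi and fPi of the metrics;
   they converge pointwise, at every (floating) Clifford system of A. *)
Definition connection_type (F : nat -> set A) n (k : 'I_n.+1)
    (omega : connection n.+1) : Prop :=
  match omega with
  | Coefficients w =>
      (forall j (iota : {ffun 'I_n.+1 -> bool}), iota j = false -> w j iota = 0)
      /\ (forall iota : {ffun 'I_n.+1 -> bool},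
            iota != [ffun=> false] -> \sum_j w j iota = 1)
  | Metric eta => positive_definite eta
  | MetricLimit eta =>
      [/\ forall m, positive_definite (eta m),
          forall Q B, clifford Q ->
            exists X, converges F (fun m => Pi_metric (eta m) Q B) X
        & forall Q B, floating_clifford Q ->
            exists Z, converges (doubled_filtration F)
                        (fun m => fPi_metric k (eta m) Q B) Z]
  end.

End Algebra.

(* Main.v *)
Require Import Defs.
From HB Require Import structures.
From mathcomp Require Import all_boot all_order all_algebra.
From mathcomp Require Import all_classical all_reals all_analysis.
From mathcomp Require Import complex.
Set Implicit Arguments.
Unset Strict Implicit.
Unset Printing Implicit Defensive.
Import Order.TTheory GRing.Theory Num.Theory.
Import numFieldNormedType.Exports.
Local Open Scope classical_set_scope.
Local Open Scope ring_scope.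

(** A Clifford system [Q] acts on the algebra through the infinitesimal
    conjugations [X |-> [X, Q_j]], a floating one through the infinitesimal
    two-sided multiplications [(X, Y) |-> X Q_j + Q_j Y].  Both are families of
    linear maps [d_j : E -> A] with companions [s_j : A -> E] for which the
    maps [c_j = 1 - s_j d_j] are commuting involutions; such a pair of families
    is called a frame ([frame]).  The joint eigenspaces of the [c_j] give the
    parts [X^iota], and the tangent space consists of the [X] without a part
    fixed by every [c_j].  On it [X |-> (d_j X)_j] is injective, and a
    connection [Pi_Q] is one of its left inverses that takes tangent values
    ([connection_map]).

    The iteration is a Newton scheme.  Let [X = Pi_Q (B - Q)] lie in level [t]
    of the filtration.  The step moves [Q] to [Q'] with [Q' - Q = d X] modulo
    level [t + 1].  Replacing [Pi_Q] by [Pi_Q'] costs only an error of level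
    [t + 1], as it is applied to [B - Q'], which has level 1.  Hence
    [Pi_Q' (B - Q')] equals [X - Pi_Q (d X) = 0] modulo level [t + 1]
    ([pi_step]), each step gains a level, and completeness yields the limit.
    Uniqueness is the same computation read backwards ([pi_unique]), because of
    rigidity: two systems that agree up to level [t] differ by some [d X]
    modulo level [t + 1].  Indeed averaging 1 under the maps
    [S |-> Q'_i S Q_i^-1] produces an element near 1 that conjugates [Q] to
    [Q'] ([intertwinerP]).  Finally [Pi_Q Q] is 0 for a Clifford system and half of
    the unit for a floating one, which turns [Pi_Q (B - Q) = 0] into the
    stated equation for [Pi_Q B].

    It remains to check that each kind of connection is such a left inverse,
    is compatible with the filtration, and depends on [Q] in a Lipschitz way.
    For a connection given by coefficients this is a computation with parts
    ([projection_connection]).  For a metric [eta] the inverse of [M] has to be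
    controlled.  Diagonalize [eta] by an orthogonal matrix; rotating [Q] by
    that matrix gives again a (floating) Clifford system, with the same tangent
    space ([fixed_part_rotation]), for which the metric is diagonal.  There [M]
    acts by a nonzero scalar on the parts [X^iota] with [iota] nonzero, so the
    metric connection of [Q] is a coefficient connection of the rotated system
    ([metric_solution], [metric_connection]).  The required properties are
    closed, so they pass to limits ([limit_connection]).

    In the floating case the [c_j] act on pairs, by
    [(X, Y) |-> (- Q_j Y Q_j^-1, - Q_j^-1 X Q_j)], and [c_i c_k] is the
    conjugation by [Q_i Q_k^-1] in the first component and by [Q_k^-1 Q_i] in
    the second.  Hence the parts relative to an auxiliary index [k] are parts
    for the [c_j] ([quotient_parts]). *)

(** * Spectral decomposition for commuting involutions *)

Section Involutions.
Variables (R : realFieldType) (E : lmodType R).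

Definition eigenpart (f : E -> E) (b : bool) (X : E) : E :=
  2^-1 *: (if b then X - f X else X + f X).

Lemma half_double (X : E) : (2^-1 : R) *: (X + X) = X.
Proof.
by rewrite -mulr2n -[X *+ 2]scaler_nat scalerA mulVf ?scale1r // pnatr_eq0.
Qed.

Variables (n : nat) (c : 'I_n -> {linear E -> E}).

Definition eigenparts (iota : 'I_n -> bool) (s : seq 'I_n) (X : E) : E :=
  foldl (fun Y i => eigenpart (c i) (iota i) Y) X s.

Definition commuting_involutions : Prop :=
  (forall i X, c i (c i X) = X) /\ (forall i j X, c i (c j X) = c j (c i X)).

Lemma eigenpart_is_linear i b : linear (eigenpart (c i) b).
Proof.
move=> a X Y; rewrite /eigenpart linearP; case: b.
  by rewrite opprD addrACA -scalerBr [LHS]scalerDr !scalerA mulrC.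
by rewrite addrACA -scalerDr [LHS]scalerDr !scalerA mulrC.
Qed.

Lemma eigenparts_cons iota i s X :
  eigenparts iota (i :: s) X = eigenparts iota s (eigenpart (c i) (iota i) X).
Proof. by []. Qed.

Lemma eigenparts_is_linear iota s : linear (eigenparts iota s).
Proof.
elim: s => [//|i s IH] a X Y.
by rewrite !eigenparts_cons eigenpart_is_linear IH.
Qed.

HB.instance Definition _ i b :=
  GRing.isLinear.Build R E E *:%R (eigenpart (c i) b) (@eigenpart_is_linear i b).
HB.instance Definition _ iota s :=
  GRing.isLinear.Build R E E *:%R (eigenparts iota s)
    (@eigenparts_is_linear iota s).

Hypothesis hc : commuting_involutions.

Lemma eigenpart_comm i j b X :
  c i (eigenpart (c j) b X) = eigenpart (c j) b (c i X).
Proof.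
rewrite /eigenpart; case: b; rewrite linearZ; congr (_ *: _).
  by rewrite linearB /= hc.2.
by rewrite linearD /= hc.2.
Qed.

Lemma eigenparts_comm i iota s X :
  c i (eigenparts iota s X) = eigenparts iota s (c i X).
Proof. by elim: s X => [//|j s IH] X; rewrite !eigenparts_cons IH eigenpart_comm. Qed.

Lemma eigenpart_id i (b : bool) X :
  c i X = (-1) ^+ b *: X -> forall b', eigenpart (c i) b' X = (b' == b)%:R *: X.
Proof.
by move=> h b'; rewrite /eigenpart h; case: b {h}; case: b';
  rewrite /= ?expr0 ?expr1 ?scale1r ?scaleN1r ?opprK ?half_double ?subrr
    ?scaler0 ?scale0r.
Qed.

Lemma eigenpart_eigen i (b : bool) X :
  c i (eigenpart (c i) b X) = (-1) ^+ b *: eigenpart (c i) b X.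
Proof.
rewrite /eigenpart scalerA [_ * 2^-1]mulrC -scalerA; case: b; rewrite linearZ /=.
  by rewrite linearB /= hc.1 expr1 scaleN1r opprB.
by rewrite linearD /= hc.1 expr0 scale1r addrC.
Qed.

Lemma eigenparts_eigen i (iota : 'I_n -> bool) s X : i \in s ->
  c i (eigenparts iota s X) = (-1) ^+ iota i *: eigenparts iota s X.
Proof.
elim: s X => [//|j s IH] X; rewrite inE => /orP[/eqP->|/IH->//].
by rewrite eigenparts_cons eigenparts_comm eigenpart_eigen linearZ.
Qed.

Lemma eigenparts_id (kappa : 'I_n -> bool) s X : (forall i, c i X = (-1) ^+ kappa i *: X) ->
  forall iota : 'I_n -> bool, eigenparts iota s X = (all (fun i => iota i == kappa i) s)%:R *: X.
Proof.
move=> hX iota; elim: s => [|j s IH]; first by rewrite scale1r.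
rewrite eigenparts_cons (eigenpart_id (hX j)) linearZ /= IH scalerA.
by case: (iota j == kappa j); rewrite ?mul1r ?mul0r.
Qed.

(** Flipping the sign at one index of [s] pairs the terms of the sum, and the two
    eigenparts for that index add up to the identity: each index of [s] halves
    the number [2 ^+ n] of copies of [X]. *)
Lemma eigenparts_sum s X : uniq s ->
  \sum_(iota : {ffun 'I_n -> bool}) eigenparts iota s X
    = 2 ^+ (n - size s) *: X.
Proof.
elim: s X => [|i s IH] X /=.
  move=> _; rewrite /eigenparts /= sumr_const subn0 card_ffun card_ord card_bool.
  by rewrite -scaler_nat natrX.
case/andP=> his us.
pose flip (iota : {ffun 'I_n -> bool}) :=
  [ffun j => if j == i then ~~ iota j else iota j].
have flipK : involutive flip.
  by move=> iota; apply/ffunP => j; rewrite !ffunE; case: eqP => //; rewrite negbK.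
have flips iota Y : eigenparts (flip iota) s Y = eigenparts iota s Y.
  elim: s his Y {IH us} => [//|j s IH']; rewrite inE negb_or => /andP[hj hs] Y /=.
  by rewrite IH' // [flip iota j]ffunE eq_sym (negbTE hj).
have h : \sum_(iota : {ffun 'I_n -> bool}) eigenparts iota (i :: s) X
    + \sum_(iota : {ffun 'I_n -> bool}) eigenparts iota (i :: s) X
    = 2 ^+ (n - size s) *: X.
  rewrite -IH // {2}(reindex_inj (inv_inj flipK)) -big_split; apply: eq_bigr => iota _ /=.
  rewrite flips -linearD ffunE eqxx; congr eigenparts.
  rewrite /eigenpart -scalerDr; case: (iota i) => /=.
    by rewrite addrACA addNr addr0 half_double.
  by rewrite addrACA subrr addr0 half_double.
have hs : (size s < n)%N.
  have: (size (i :: s) <= n)%N; last by [].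
  have /card_uniqP <- : uniq (i :: s) by rewrite /= his.
  by rewrite -[leqRHS]card_ord max_card.
rewrite -[LHS]half_double h scalerA -subSS subSn // exprS mulrA mulVf ?mul1r //.
Qed.

Local Notation parts iota X := (eigenparts iota (enum 'I_n) X).

Lemma parts_eigen i (iota : 'I_n -> bool) X : c i (parts iota X) = (-1) ^+ iota i *: parts iota X.
Proof. by apply: eigenparts_eigen; rewrite mem_enum. Qed.

Lemma parts_sum X : \sum_(iota : {ffun 'I_n -> bool}) parts iota X = X.
Proof.
by rewrite eigenparts_sum ?enum_uniq // size_enum_ord subnn scale1r.
Qed.

Lemma parts_id (kappa iota : {ffun 'I_n -> bool}) X :
  (forall i, c i X = (-1) ^+ kappa i *: X) -> parts iota X = (iota == kappa)%:R *: X.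
Proof.
move=> hX; rewrite (eigenparts_id _ hX); congr (_%:R *: _).
congr nat_of_bool; apply/allP/eqP => [h|-> //].
by apply/ffunP => i; apply/eqP/h; rewrite mem_enum.
Qed.

Lemma parts_parts (kappa iota : {ffun 'I_n -> bool}) X :
  parts iota (parts kappa X) = (iota == kappa)%:R *: parts kappa X.
Proof. by apply: parts_id => i; rewrite parts_eigen. Qed.

Lemma parts_c i (iota : 'I_n -> bool) X : parts iota (c i X) = (-1) ^+ iota i *: parts iota X.
Proof. by rewrite -eigenparts_comm parts_eigen. Qed.

(** An eigenvector of [c i] for the eigenvalue -1 has parts only where [iota i] is
    true. *)
Lemma parts_odd i iota X : c i X = - X -> iota i = false -> parts iota X = 0.
Proof.
move=> hX hi; have := parts_c i iota X; rewrite hX linearN hi expr0 scale1r => h.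
by rewrite -[LHS]half_double -{1}h addNr scaler0.
Qed.

End Involutions.

(** * Reflection frames *)

Section Frame.
Variables (R : realFieldType) (E V : lmodType R) (n : nat).
Variables (d : 'I_n -> {linear E -> V}) (s : 'I_n -> {linear V -> E}).

Definition reflection j (X : E) : E := X - s j (d j X).

Lemma reflection_is_linear j : linear (reflection j).
Proof.
by move=> a X Y; rewrite /reflection 2!linearP opprD addrACA -scalerBr.
Qed.

HB.instance Definition _ j :=
  GRing.isLinear.Build R E E *:%R (reflection j) (@reflection_is_linear j).

(** The first two conditions say that [s j \o d j] is twice an idempotent and
    that [s j] and [d j] take part only in the eigenspace of [reflection j] for
    the eigenvalue -1. *)
Definition frame : Prop :=
  [/\ forall j Y, s j (d j (s j Y)) = s j Y + s j Y,
      forall j X, d j (s j (d j X)) = d j X + d j X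
    & forall i j X,
        reflection i (reflection j X) = reflection j (reflection i X)].

Definition fparts (iota : 'I_n -> bool) (X : E) : E :=
  eigenparts (fun j => reflection j : {linear E -> E}) iota (enum 'I_n) X.

HB.instance Definition _ iota :=
  GRing.isLinear.Build R E E *:%R (fparts iota)
    (@eigenparts_is_linear R E n (fun j => reflection j) iota (enum 'I_n)).

Definition fixed_part : E -> E := fparts [ffun=> false].

HB.instance Definition _ := GRing.Linear.on fixed_part.

Hypothesis hf : frame.

Lemma frame_involutions :
  commuting_involutions (fun j => reflection j : {linear E -> E}).
Proof.
case: hf => h1 h2 h3; split => [i X|]; last exact: h3.
by rewrite /= /reflection (linearB (d i)) (linearB (s i)) /= h1 opprB addrK subrK.
Qed.

Lemma reflection_s j Y : reflection j (s j Y) = - s j Y.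
Proof. by rewrite /reflection; case: hf => -> _ _; rewrite opprD addNKr. Qed.

Lemma fparts_s j (iota : 'I_n -> bool) Y : iota j = false -> fparts iota (s j Y) = 0.
Proof.
by move=> h; apply: (parts_odd frame_involutions (reflection_s j Y)).
Qed.

Lemma fixed_part_s j Y : fixed_part (s j Y) = 0.
Proof. by apply: fparts_s; rewrite ffunE. Qed.

Lemma fparts_sd j (iota : 'I_n -> bool) X :
  fparts iota (s j (d j X)) = (if iota j then 2 else 0) *: fparts iota X.
Proof.
have -> : s j (d j X) = X - reflection j X by rewrite opprB addrC subrK.
rewrite linearB /= /fparts (parts_c frame_involutions).
by case: (iota j); rewrite ?expr0 ?expr1 ?scaleN1r ?scale1r ?opprK ?subrr ?scale0r // scaler_nat.
Qed.

Lemma sd_fparts j (iota : 'I_n -> bool) X :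
  s j (d j (fparts iota X)) = (if iota j then 2 else 0) *: fparts iota X.
Proof.
have -> Y : s j (d j Y) = Y - reflection j Y by rewrite opprB addrC subrK.
rewrite /fparts (parts_eigen frame_involutions).
by case: (iota j); rewrite ?expr0 ?expr1 ?scaleN1r ?scale1r ?opprK ?subrr ?scale0r // scaler_nat.
Qed.

Lemma fparts_sum X : \sum_(iota : {ffun 'I_n -> bool}) fparts iota X = X.
Proof. exact: parts_sum. Qed.

Lemma fixed_part_fparts (iota : {ffun 'I_n -> bool}) X :
  iota != [ffun=> false] -> fixed_part (fparts iota X) = 0.
Proof.
move=> h; rewrite /fixed_part /fparts (parts_parts frame_involutions).
by rewrite eq_sym (negbTE h) scale0r.
Qed.

Lemma fixed_part_id X : (forall j, d j X = 0) -> fixed_part X = X.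
Proof.
move=> h; rewrite /fixed_part /fparts.
rewrite (@parts_id _ _ _ _ [ffun=> false]) ?eqxx ?scale1r // => j.
by rewrite ffunE expr0 scale1r /= /reflection h linear0 subr0.
Qed.

Lemma d_fixed_part j X : d j (fixed_part X) = 0.
Proof.
have h : s j (d j (fixed_part X)) = 0.
  by rewrite /fixed_part sd_fparts ffunE scale0r.
by rewrite -[LHS]half_double; case: hf => _ <- _; rewrite h linear0 scaler0.
Qed.

Lemma fixed_part_idem X : fixed_part (fixed_part X) = fixed_part X.
Proof. by apply: fixed_part_id => j; exact: d_fixed_part. Qed.

(** [X] and its fixed part differ by a sum of elements of the images of the maps
    [s j]. *)
Lemma kill_fixed_part (f : {linear E -> E}) X :
  (forall j Y, f (s j Y) = 0) -> f (fixed_part X) = f X.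
Proof.
move=> hk; rewrite /fixed_part /fparts; elim: (enum _) X => [//|j t IH] X.
rewrite eigenparts_cons IH /eigenpart ffunE /= /reflection linearZ.
by rewrite linearD linearB /= hk subr0 half_double.
Qed.

(** * Connections with coefficients *)

Definition weights (w : 'I_n -> {ffun 'I_n -> bool} -> R) : Prop :=
  (forall j (iota : {ffun 'I_n -> bool}), iota j = false -> w j iota = 0)
  /\ (forall iota : {ffun 'I_n -> bool},
        iota != [ffun=> false] -> \sum_j w j iota = 1).

(** Only the values [s j (B j)], which are odd under [reflection j], enter here,
    whereas the classical formula uses a part [(B_j Q_j^-1)^iota].  The two agree
    where [iota j] holds, hence wherever the weight may be nonzero. *)
Definition projection w (B : 'I_n -> V) : E :=
  2^-1 *: \sum_j \sum_(iota : {ffun 'I_n -> bool}) w j iota *: fparts iota (s j (B j)).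

Lemma weighted_sum w X : weights w ->
  \sum_j \sum_(iota : {ffun 'I_n -> bool}) w j iota *: fparts iota X
    = X - fixed_part X.
Proof.
move=> [w0 w1]; rewrite exchange_big /= -[X in X - _]fparts_sum.
rewrite (bigD1 [ffun=> false]) //= [in RHS](bigD1 [ffun=> false]) //=.
rewrite big1 ?add0r => [|j _]; last by rewrite w0 ?scale0r // ffunE.
rewrite [X in _ = X - _]addrC addrK; apply: eq_bigr => iota hi.
by rewrite -scaler_suml w1 // scale1r.
Qed.

Lemma fixed_part_projection w B : weights w -> fixed_part (projection w B) = 0.
Proof.
move=> [w0 _]; rewrite linearZ /= linear_sum big1 ?scaler0 // => j _.
rewrite linear_sum big1 // => iota _; rewrite linearZ /=.
case: (eqVneq iota [ffun=> false]) => [->|/fixed_part_fparts->].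
  by rewrite w0 ?scale0r // ffunE.
by rewrite scaler0.
Qed.

Lemma projection_d w X : weights w ->
  projection w (fun j => d j X) = X - fixed_part X.
Proof.
move=> hw; rewrite /projection -[RHS]half_double -(weighted_sum X hw).
congr (_ *: _); rewrite -big_split; apply: eq_bigr => j _.
rewrite -big_split; apply: eq_bigr => iota _ /=.
rewrite fparts_sd; case hi: (iota j); last by rewrite hw.1 // !scale0r add0r.
by rewrite scaler_nat mulr2n scalerDr.
Qed.

Lemma projection_const w B u (j0 : 'I_n) : weights w ->
  (forall j, s j (B j) = u) -> projection w B = 2^-1 *: u.
Proof.
move=> hw hu; rewrite /projection; congr (_ *: _).
have u0 : fixed_part u = 0 by rewrite -(hu j0) fixed_part_s.
rewrite -[RHS]subr0 -[X in _ = _ - X]u0 -(weighted_sum u hw).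
by apply: eq_bigr => j _; rewrite hu.
Qed.

(** * Diagonal metrics *)

Variable (D : 'I_n -> R).
Hypothesis D0 : forall j, 0 < D j.

Definition diag_weights (j : 'I_n) (iota : {ffun 'I_n -> bool}) : R :=
  if iota j then D j / \sum_(h | iota h) D h else 0.

Lemma diag_sum_gt0 (iota : 'I_n -> bool) j : iota j -> 0 < \sum_(h | iota h) D h.
Proof.
move=> h; rewrite (bigD1 j) //= ltr_pwDl // sumr_ge0 // => i _; exact: ltW.
Qed.

(** The sum of the [D h] with [iota h] is, up to a factor 2, the eigenvalue of the
    diagonal metric operator on the part [iota]; dividing by it inverts the
    operator. *)
Lemma diag_weightsP : weights diag_weights.
Proof.
split=> [j iota|iota hi]; first by rewrite /diag_weights => ->.
have [j hj] : exists j, iota j.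
  apply: contraPP hi => /forallNP h; apply/negP; rewrite negbK; apply/eqP/ffunP => j.
  by rewrite ffunE; apply/negbTE/negP/h.
rewrite /diag_weights -big_mkcond /= -mulr_suml divff // gt_eqF //.
exact: diag_sum_gt0 hj.
Qed.

Lemma diag_metric_fparts (iota : {ffun 'I_n -> bool}) X :
  \sum_j D j *: s j (d j (fparts iota X))
    = (2 * \sum_(h | iota h) D h) *: fparts iota X.
Proof.
rewrite [in RHS]big_mkcond mulr_sumr scaler_suml; apply: eq_bigr => j _.
by rewrite sd_fparts scalerA mulrC; case: (iota j); rewrite ?mulr0 ?mul0r.
Qed.

Lemma diag_metric_projection B :
  \sum_j D j *: s j (d j (projection diag_weights B)) = \sum_j D j *: s j (B j).
Proof.
have [N NE] : exists N : {linear E -> E}, forall X, N X = \sum_j D j *: s j (d j X).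
  pose N X := \sum_j D j *: s j (d j X).
  have Nlin : linear N.
    move=> a X Y; rewrite /N scaler_sumr -big_split; apply: eq_bigr => j _.
    by rewrite (linearP (d j)) (linearP (s j)) /= scalerDr !scalerA [_ * a]mulrC.
  pose N' := GRing.isLinear.Build R E E *:%R N Nlin.
  pose Nl : {linear E -> E} := HB.pack N N'.
  by exists Nl.
rewrite -NE /projection linearZ /= linear_sum scaler_sumr.
apply: eq_bigr => j _; rewrite linear_sum -[s j (B j) in RHS]fparts_sum !scaler_sumr.
apply: eq_bigr => iota _; rewrite linearZ /= NE diag_metric_fparts !scalerA.
rewrite /diag_weights; case hj: (iota j); last by rewrite fparts_s // !scaler0.
congr (_ *: _); rewrite mulrACA mulVf ?pnatr_eq0 // mul1r mulfVK // gt_eqF //.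
exact: diag_sum_gt0 hj.
Qed.

Lemma diag_metric_inj X : fixed_part X = 0 ->
  \sum_j D j *: s j (d j X) = 0 -> X = 0.
Proof.
move=> hX hN; rewrite -[X]fparts_sum big1 // => iota _.
case: (eqVneq iota [ffun=> false]) => [->|hi]; first exact: hX.
have [j hj] : exists j, iota j.
  apply: contraPP hi => /forallNP h; apply/negP; rewrite negbK; apply/eqP/ffunP => j.
  by rewrite ffunE; apply/negbTE/negP/h.
have: (2 * \sum_(h | iota h) D h) *: fparts iota X = 0.
  rewrite -[RHS](linear0 (fparts iota)) -[X in _ = fparts iota X]hN linear_sum.
  rewrite big_mkcond mulr_sumr scaler_suml; apply: eq_bigr => i _.
  by rewrite linearZ /= fparts_sd scalerA mulrC; case: (iota i); rewrite ?mulr0 ?mul0r.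
move/eqP; rewrite scaler_eq0 mulf_eq0 pnatr_eq0 /= gt_eqF ?(diag_sum_gt0 hj) //=.
by move/eqP.
Qed.

End Frame.

(** * Rotated frames and general metrics *)
Section Rotation.
Variables (R : realFieldType) (E V : lmodType R) (n : nat).
Variables (d d' : 'I_n -> {linear E -> V}) (s s' : 'I_n -> {linear V -> E}).
Variable (O : 'M[R]_n).
Hypothesis (hO : O *m O^T = 1%:M).
Hypothesis (hd' : forall a X, d' a X = \sum_j O a j *: d j X).
Hypothesis (hs' : forall a Y, s' a Y = \sum_j O a j *: s j Y).
Hypothesis (hf : frame d s) (hf' : frame d' s').

Lemma orthogonal_dot (i j : 'I_n) : \sum_a O a i * O a j = (i == j)%:R.
Proof.
have := mulmx1C hO => /matrixP /(_ i j); rewrite !mxE => <-.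
by apply: eq_bigr => a _; rewrite mxE.
Qed.

Lemma unrotate (W : lmodType R) (Y : 'I_n -> W) i :
  Y i = \sum_a O a i *: \sum_j O a j *: Y j.
Proof.
under eq_bigr do rewrite scaler_sumr.
rewrite exchange_big (bigD1 i) //= [X in _ = _ + X]big1 ?addr0 => [|j hj].
  under eq_bigr do rewrite scalerA.
  by rewrite -scaler_suml orthogonal_dot eqxx scale1r.
under eq_bigr do rewrite scalerA.
by rewrite -scaler_suml orthogonal_dot eq_sym (negbTE hj) scale0r.
Qed.

(** Each of the two fixed parts is the projection onto the common kernel of the
    maps [d j], along the sum of the images of the maps [s j]; neither space
    changes when the families are rotated. *)
Lemma fixed_part_rotation X : fixed_part d' s' X = fixed_part d s X.
Proof.
transitivity (fixed_part d s (fixed_part d' s' X)).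
 apply/esym/fixed_part_id => j; rewrite [LHS](unrotate (fun j => d j _)) big1 // => a _.
  by rewrite -hd' d_fixed_part // scaler0.
apply: kill_fixed_part => a Y; rewrite hs' linear_sum big1 // => j _.
by rewrite linearZ /= fixed_part_s // scaler0.
Qed.

Variables (D : 'I_n -> R) (eta : 'M[R]_n).
Hypothesis D0 : forall j, 0 < D j.
Hypothesis heta : forall i j, eta i j = \sum_a O a i * D a * O a j.

Lemma metric_rotation (Y : 'I_n -> V) :
  \sum_i \sum_j eta i j *: s i (Y j)
    = \sum_a D a *: s' a (\sum_j O a j *: Y j).
Proof.
under [RHS]eq_bigr => a _.
  rewrite hs' scaler_sumr.
  under eq_bigr => i _ do rewrite linear_sum !scaler_sumr.
  over.
rewrite [RHS]exchange_big; apply: eq_bigr => i _.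
rewrite [RHS]exchange_big; apply: eq_bigr => j _.
rewrite heta scaler_suml; apply: eq_bigr => a _.
by rewrite [s i (_ *: _)]linearZ /= !scalerA [D a * _]mulrC.
Qed.

Definition rotated_projection (B : 'I_n -> V) : E :=
  projection d' s' (diag_weights D) (fun a => \sum_j O a j *: B j).

(** In the rotated frame the metric is diagonal, so its solution is the coefficient
    connection of [diag_weights]. *)
Lemma metric_solution B :
  \sum_i \sum_j eta i j *: s i (d j (rotated_projection B))
    = \sum_i \sum_j eta i j *: s i (B j).
Proof.
rewrite !metric_rotation -[RHS](diag_metric_projection hf' D0).
by apply: eq_bigr => a _; rewrite -hd'.
Qed.

Lemma metric_inj X : fixed_part d s X = 0 ->
  \sum_i \sum_j eta i j *: s i (d j X) = 0 -> X = 0.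
Proof.
rewrite -fixed_part_rotation metric_rotation => hX hN.
apply: (diag_metric_inj hf' D0 hX); rewrite -[RHS]hN.
by apply: eq_bigr => a _; rewrite -hd'.
Qed.

End Rotation.

(** * Orthogonal diagonalization of real symmetric matrices *)

Section Spectral.
Variable R : rcfType.

Lemma norm2E n (v : 'rV[R]_n) : (v *m v^T) 0 0 = \sum_i v 0 i ^+ 2.
Proof. by rewrite mxE; apply: eq_bigr => i _; rewrite mxE expr2. Qed.

Lemma norm2_ge0 n (v : 'rV[R]_n) : 0 <= (v *m v^T) 0 0.
Proof. by rewrite norm2E sumr_ge0 // => i _; exact: sqr_ge0. Qed.

Lemma norm2_eq0 n (v : 'rV[R]_n) : ((v *m v^T) 0 0 == 0) = (v == 0).
Proof.
apply/eqP/eqP => [|->]; last by rewrite mul0mx mxE.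
rewrite norm2E => /psumr_eq0P h; apply/rowP => i; apply/eqP.
by rewrite mxE -sqrf_eq0 h // => j _; exact: sqr_ge0.
Qed.

(** For a complex eigenvector [x + i y] with eigenvalue [a + i b], comparing
    [y S x^T] with its transpose [x S y^T] gives [b (|x|^2 + |y|^2) = 0]; so
    [b = 0], and [x] or [y] is a real eigenvector. *)
Lemma symmetric_eigenvector n (S : 'M[R]_n.+1) : S^T = S ->
  exists (v : 'rV[R]_n.+1) (a : R), v != 0 /\ v *m S = a *: v.
Proof.
move=> hS; pose g := map_mx (real_complex R) S.
have /closed_rootP[l] : size (char_poly g) != 1%N by rewrite size_char_poly.
rewrite -eigenvalue_root_char => /eigenvalueP[v hv v0].
pose x := map_mx (@complex.Re R) v; pose y := map_mx (@complex.Im R) v.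
pose a := complex.Re l; pose b := complex.Im l.
have hxy : x *m S = a *: x - b *: y /\ y *m S = a *: y + b *: x.
  split; apply/rowP => j; have /rowP/(_ j) := hv; rewrite !mxE => h.
    have := congr1 (@complex.Re R) h; rewrite /g raddf_sum /=.
    under eq_bigr => i _ do rewrite !mxE.
    rewrite /a /b; case: (l) => la lb; case: (v 0 j) => vr vi /= <-.
    by apply: eq_bigr => i _; rewrite mxE; case: (v 0 i) => p q /=; rewrite mulr0 subr0.
  have := congr1 (@complex.Im R) h; rewrite /g raddf_sum /=.
  under eq_bigr => i _ do rewrite !mxE.
  rewrite /a /b; case: (l) => la lb; case: (v 0 j) => vr vi /= <-.
  by apply: eq_bigr => i _; rewrite mxE; case: (v 0 i) => p q /=; rewrite mulr0 add0r.
have [hx hy] := hxy.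
have b0 : b = 0.
  have h : y *m S *m x^T = (x *m S *m y^T)^T.
    by rewrite !trmx_mul trmxK hS mulmxA.
  have hyx : (y *m x^T) = (x *m y^T)^T by rewrite trmx_mul trmxK.
  move: h; rewrite hx hy mulmxDl mulmxBl -!scalemxAl => /matrixP/(_ 0 0).
  rewrite [RHS]mxE hyx !mxE => /eqP.
  rewrite -subr_eq0 opprB [X in X == 0]addrC [X in X == 0]addrA subrK -mulrDr mulf_eq0 => /orP[/eqP->//|].
  have := norm2_ge0 x; have := norm2_ge0 y; rewrite !mxE => y_ge x_ge.
  rewrite paddr_eq0 // => /andP[].
  have := norm2_eq0 x; have := norm2_eq0 y; rewrite !mxE => -> -> /eqP yz /eqP xz.
  case/eqP: v0; apply/rowP => j; move/rowP/(_ j): xz; move/rowP/(_ j): yz.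
  by rewrite !mxE; case: (v 0 j) => p q /= -> ->.
move: hx hy; rewrite b0 !scale0r subr0 addr0 => hx hy.
have [xz|x0] := eqVneq x 0; last by exists x, a.
have [yz|y0] := eqVneq y 0; last by exists y, a.
case/eqP: v0; apply/rowP => j; move/rowP/(_ j): xz; move/rowP/(_ j): yz.
by rewrite !mxE; case: (v 0 j) => p q /= -> ->.
Qed.

(** [H] is the reflection in the hyperplane orthogonal to [u - v]. *)
Lemma orthogonal_transitive n (u v : 'rV[R]_n) :
  u *m u^T = 1%:M -> v *m v^T = 1%:M ->
  exists H : 'M[R]_n, H *m H^T = 1%:M /\ u *m H = v.
Proof.
move=> hu hv; have [<-|uv] := eqVneq u v.
  by exists 1%:M; rewrite trmx1 !mulmx1.
pose w := u - v; pose N := (w *m w^T) 0 0.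
have N0 : N != 0 by rewrite norm2_eq0 subr_eq0.
have wwE : w *m w^T = N%:M by rewrite [LHS]mx11_scalar.
pose K := w^T *m w; pose c := 2 / N; pose H := 1%:M - c *: K.
have HT : H^T = H by rewrite linearB /= linearZ /= trmx1 trmx_mul trmxK.
have KK : K *m K = N *: K.
  by rewrite /K mulmxA -(mulmxA w^T) wwE mul_mx_scalar -scalemxAl.
exists H; split.
  rewrite HT {2}/H mulmxBr mulmx1 /H -scalemxAr mulmxBl mul1mx -scalemxAl KK.
  rewrite scalerBr !scalerA -mulrA.
  have -> : c * (c * N) = c + c by rewrite /c mulfVK // mulr_natr mulr2n.
  by rewrite scalerDl opprB addrK subrK.
have h : 2 *: (u *m w^T) = N%:M.
  have vuT : v *m u^T = u *m v^T.
    rewrite -[v in LHS]trmxK -trmx_mul; apply/matrixP => i j.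
    by rewrite mxE !ord1.
  rewrite -wwE /w linearB /= mulmxBl !mulmxBr hu hv vuT opprB.
  by rewrite scaler_nat mulr2n.
rewrite mulmxBr mulmx1 -scalemxAr mulmxA scalemxAl.
rewrite /c [2 / N]mulrC -scalerA h scale_scalar_mx mulVf // mul1mx.
by rewrite opprB addrC subrK.
Qed.

(** An orthogonal matrix [H] moves a unit eigenvector to the first basis vector.
    The conjugate of [S] by [H] is then block diagonal by symmetry, and its lower
    block is diagonalized by induction. *)
Theorem symmetric_diagonalization n (S : 'M[R]_n) : S^T = S ->
  exists (O : 'M[R]_n) (D : 'rV[R]_n),
    O *m O^T = 1%:M /\ S = O^T *m diag_mx D *m O.
Proof.
elim: n S => [|n IH] S hS.
  by exists 1%:M, 0; split; apply/matrixP; case.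
have [v [a [v0 hv]]] := symmetric_eigenvector hS.
have [u [hu huS]] : exists u : 'rV[R]_n.+1, u *m u^T = 1%:M /\ u *m S = a *: u.
  pose r := Num.sqrt ((v *m v^T) 0 0).
  have r0 : r != 0 by rewrite sqrtr_eq0 -ltNge lt_neqAle norm2_ge0 eq_sym norm2_eq0 v0.
  exists (r^-1 *: v); split; last by rewrite -scalemxAl hv scalerA mulrC -scalerA.
  rewrite linearZ /= -scalemxAl -scalemxAr scalerA [v *m v^T]mx11_scalar.
  rewrite scale_scalar_mx -(sqr_sqrtr (norm2_ge0 v)) -/r expr2.
  by rewrite mulrACA mulVf // mulr1.
pose e : 'rV[R]_(1 + n) := row_mx 1%:M 0.
have he : e *m e^T = 1%:M.
  by rewrite /e tr_row_mx mul_row_col trmx1 mul1mx mul0mx addr0.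
have [H [hH heH]] := orthogonal_transitive he hu.
have hH' : H^T *m H = 1%:M := mulmx1C hH.
pose S1 : 'M[R]_(1 + n) := H *m S *m H^T.
have S1T : S1^T = S1 by rewrite /S1 !trmx_mul trmxK hS mulmxA.
have heS1 : e *m S1 = a *: e.
  by rewrite /S1 !mulmxA heH huS -scalemxAl -heH -mulmxA hH mulmx1.
have S1E : S1 = block_mx a%:M 0 0 (drsubmx S1).
  have hup : usubmx S1 = a *: e.
    by rewrite -heS1 -[in RHS](vsubmxK S1) /e mul_row_col mul1mx mul0mx addr0.
  have hul : ulsubmx S1 = a%:M.
    by rewrite /ulsubmx hup linearZ /= row_mxKl scale_scalar_mx mulr1.
  have hur : ursubmx S1 = 0 by rewrite /ursubmx hup linearZ /= row_mxKr scaler0.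
  have hdl : dlsubmx S1 = 0 by rewrite -S1T -trmx_ursub hur trmx0.
  by rewrite -[LHS](submxK S1) hul hur hdl.
have [|O' [D' [hO' hD']]] := IH (drsubmx S1).
  by rewrite trmx_drsub S1T.
pose P : 'M[R]_(1 + n) := block_mx 1%:M 0 0 O'.
have PT : P^T = block_mx 1%:M 0 0 O'^T.
  by rewrite /P tr_block_mx !trmx0 trmx1.
have hP : P *m P^T = 1%:M.
  rewrite PT /P mulmx_block !mulmx0 !mul0mx mulmx1 addr0 !add0r hO'.
  by rewrite -scalar_mx_block.
exists (P *m H), (row_mx (a%:M : 'rV[R]_1) D'); split.
  by rewrite trmx_mul mulmxA -(mulmxA P) hH mulmx1.
have -> : S = H^T *m S1 *m H by rewrite /S1 !mulmxA hH' mul1mx -mulmxA hH' mulmx1.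
rewrite S1E hD' trmx_mul -!mulmxA; congr (_ *m _); rewrite !mulmxA; congr (_ *m _).
have -> : block_mx (a%:M : 'M[R]_1) 0 0 (O'^T *m diag_mx D' *m O')
    = P^T *m (diag_mx (row_mx (a%:M : 'rV[R]_1) D') : 'M[R]_(1 + n)) *m P.
  rewrite PT /P diag_mx_row !mulmx_block.
  rewrite !(mulmx0, mul0mx, mulmx1, mul1mx, addr0, add0r).
  congr block_mx; apply/matrixP => i j; rewrite !ord1 !mxE.
  by rewrite eqxx mulr1n.
by [].
Qed.

(** The eigenvalue [D a] is the value of the quadratic form at row [a] of [O]. *)
Lemma positive_definite_diagonalization n (S : 'M[R]_n) :
  S^T = S -> (forall v : 'rV[R]_n, v != 0 -> 0 < (v *m S *m v^T) 0 0) ->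
  exists (O : 'M[R]_n) (D : 'I_n -> R),
    [/\ O *m O^T = 1%:M, forall a, 0 < D a
      & forall i j, S i j = \sum_a O a i * D a * O a j].
Proof.
move=> /symmetric_diagonalization[P [D [hP hS]]] pos.
exists P, (fun a => D 0 a); split; first exact: hP.
  move=> a.
  have := pos (row a P); rewrite hS.
  have hr : row a P *m P^T = row a 1%:M by rewrite -row_mul hP.
  have -> : row a P *m (P^T *m diag_mx D *m P) *m (row a P)^T
      = row a 1%:M *m diag_mx D *m (row a 1%:M)^T.
    by rewrite -hr trmx_mul trmxK !mulmxA.
  rewrite row1 -rowE trmx_delta -colE !mxE eqxx mulr1n; apply.
  apply/eqP => h; have : row a P *m P^T = 0 by rewrite h mul0mx.
  by rewrite hr => /rowP/(_ a); rewrite !mxE eqxx => /eqP; rewrite oner_eq0.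
move=> i j; rewrite hS mxE; apply: eq_bigr => a _; congr (_ * _).
rewrite mxE (bigD1 a) //= big1 => [|b hb].
  by rewrite !mxE eqxx mulr1n addr0.
by rewrite !mxE (negbTE hb) mulr0.
Qed.

End Spectral.

(** * Convergence and exponentials in a convenient algebra *)

Section Convenient.
Variables (R : realType) (A : algType R) (F : nat -> set A).
Hypothesis hF : convenient F.

Lemma filt0 i : F i 0. Proof. exact: filtration_mem0. Qed.

Lemma filtD i x y : F i x -> F i y -> F i (x + y).
Proof. by move=> hx hy; rewrite -[x]scale1r; apply: filtration_linear. Qed.

Lemma filtZ i a x : F i x -> F i (a *: x).
Proof.
by move=> hx; rewrite -[a *: x]addr0; apply: filtration_linear => //; exact: filt0.
Qed.

Lemma filtN i x : F i x -> F i (- x).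
Proof. by rewrite -scaleN1r; exact: filtZ. Qed.

Lemma filtB i x y : F i x -> F i y -> F i (x - y).
Proof. by move=> hx hy; apply: filtD => //; exact: filtN. Qed.

Lemma filt_sym i x y : F i (x - y) -> F i (y - x).
Proof. by rewrite -[y - x]opprB; exact: filtN. Qed.

Lemma filt_trans i y x z : F i (x - y) -> F i (y - z) -> F i (x - z).
Proof. by move=> h1 h2; rewrite -[x](subrK y) -addrA; exact: filtD. Qed.

Lemma filt_sum i (I : Type) (r : seq I) (P : pred I) (f : I -> A) :
  (forall j, P j -> F i (f j)) -> F i (\sum_(j <- r | P j) f j).
Proof. by move=> h; elim/big_ind: _ => //; [exact: filt0|exact: filtD]. Qed.

Lemma filt_le i j x : (i <= j)%N -> F j x -> F i x.
Proof.
move=> /subnK <-; elim: (j - i)%N => [//|k IH]; rewrite addSn => /(filtration_decr hF).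
exact: IH.
Qed.

Lemma filt_total x : F 0 x.
Proof. by rewrite (filtration0 hF). Qed.

Lemma filtMl i x y : F i x -> F i (y * x).
Proof. by move=> h; apply: (filtration_mul hF (filt_total y) h). Qed.

Lemma filtMr i x y : F i x -> F i (x * y).
Proof. by move=> h; rewrite -(addn0 i); apply: (filtration_mul hF h (filt_total y)). Qed.

Lemma filtX i m x : F i x -> F (m * i) (x ^+ m).
Proof.
move=> h; elim: m => [|m IH]; first exact: filt_total.
by rewrite exprS mulSn; exact: filtration_mul.
Qed.

Lemma filt_separated x : (forall i, F i x) -> x = 0.
Proof.
by move=> h; have : (\bigcap_i F i) x by []; rewrite (filtration_hausdorff hF).
Qed.

Lemma filt_eq x y : (forall i, F i (x - y)) -> x = y.
Proof. by move=> /filt_separated/eqP; rewrite subr_eq0 => /eqP. Qed.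

Lemma filt_cauchy (u : nat -> A) : (forall m, F m (u m.+1 - u m)) ->
  exists x, forall m, F m (u m - x).
Proof.
move=> h.
have hu m k : F m (u (m + k)%N - u m).
  elim: k => [|k IH]; first by rewrite addn0 subrr; exact: filt0.
  by rewrite addnS; apply: filt_trans IH; apply: filt_le (h _); rewrite leq_addr.
have [i|x hx] := filtration_complete hF (u := u).
  exists i => k l /subnKC <- /subnKC <-.
  by apply: (@filt_trans i (u i)); [|apply: filt_sym]; exact: hu.
exists x => m; have [N hN] := hx m.
apply: (@filt_trans m (u (m + N)%N)); first by apply: filt_sym; exact: hu.
by apply: hN; rewrite leq_addl.
Qed.

Lemma filtered_converges (u : nat -> A) l :
  (forall m, F m (u m - l)) -> converges F u l.
Proof.
move=> h i d p [_ hp]; apply: cvg_near_cst; exists i => // m /= him.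
by apply/eqP; rewrite -subr_eq0 -linearB; apply/eqP/hp; apply: filt_le (h m).
Qed.

Lemma converges_cst l : converges F (fun=> l) l.
Proof. by apply: filtered_converges => m; rewrite subrr; exact: filt0. Qed.

Lemma convergesB u l u' l' : converges F u l -> converges F u' l' ->
  converges F (fun m => u m - u' m) (l - l').
Proof.
move=> h h' i d p hp; rewrite linearB.
have -> : (fun m => p (u m - u' m)) = (fun m => p (u m) - p (u' m)).
    by apply: funext => m; rewrite linearB.
by apply: cvgB; [exact: (h i d p hp)|exact: (h' i d p hp)].
Qed.

Lemma converges_closed u l i : (forall m, F i (u m)) -> converges F u l -> F i l.
Proof.
move=> hu hl; have [d [p hp]] := filtration_findim hF i.
apply/hp.2/(cvg_unique (@norm_hausdorff _ _) (hl i d p hp)).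
by apply: cvg_near_cst; apply: nearW => m; apply/hp.2.
Qed.

Lemma converges_unique u l l' : converges F u l -> converges F u l' -> l = l'.
Proof.
move=> h h'; apply: filt_eq => i; apply: (converges_closed _ (convergesB h h')) => m.
by rewrite subrr; exact: filt0.
Qed.

Lemma flimE u l : converges F u l -> flim F u = l.
Proof.
move=> h; apply: (converges_unique _ h).
by apply: (@xgetPex _ 0 [set l | converges F u l]); exists l.
Qed.

(** No continuity of linear maps between the quotients has to be invoked: [1 + e] is
    invertible with inverse [1 - e / 2] and preserves [F i], so composing
    coordinates [p] of the quotient by [F i] with it gives coordinates [q] of the
    same quotient, and [p (e x) = q x - p x]. *)
Lemma converges_idempotent (e : {linear A -> A}) u l :
  (forall x, e (e x) = e x) -> (forall i x, F i x -> F i (e x)) ->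
  converges F u l -> converges F (fun m => e (u m)) (e l).
Proof.
move=> ee eF hu i d p hp.
pose q x := p (x + e x).
have qlin : linear q.
  by move=> a x y; rewrite /q (linearP e) /= addrACA -scalerDr linearP.
pose q' := GRing.isLinear.Build R A 'rV[R]_d *:%R q qlin.
pose ql : {linear A -> 'rV[R]_d} := HB.pack q q'.
have hq : quotient_coordinates (F i) ql.
  split=> [|x].
    rewrite -subTset => y _; have [x _ <-] : range p y by rewrite hp.1.
    exists (x - 2^-1 *: e x) => //=; rewrite /q (linearB e) [e (_ *: _)]linearZ /= ee.
    by rewrite -[X in _ + (X - _)](@half_double R) scalerDr addrK subrK.
  split=> [/hp.2 h|h]; last by apply/hp.2/filtD => //; exact: eF.
  have -> : x = (x + e x) - 2^-1 *: e (x + e x).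
    by rewrite linearD /= ee half_double addrK.
  by apply: filtB => //; apply/filtZ/eF.
have pe x : p (e x) = ql x - p x.
  by rewrite /= /q linearD addrAC subrr add0r.
rewrite pe; have -> : (fun m => p (e (u m))) = (fun m => ql (u m) - p (u m)).
  by apply: funext => m; rewrite pe.
by apply: cvgB; [exact: (hu i d ql hq)|exact: (hu i d p hp)].
Qed.

(** The terms of degree at least 2 have level [2 t], hence [t + 1]. *)
Lemma exponential_approx X t : (0 < t)%N -> F t X -> F t.+1 (fexp F X - 1 - X).
Proof.
move=> t0 hX; pose u := series (fun m => (m`!%:R : R)^-1 *: X ^+ m).
have hX' m : F (m * t) ((m`!%:R : R)^-1 *: X ^+ m) by apply/filtZ/filtX.
have [x hx] : exists x, forall m, F m (u m - x).
  apply: filt_cauchy => m; rewrite /u /series /= big_nat_recr //= addrAC subrr add0r.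
  by apply: filt_le (hX' m); rewrite leq_pmulr.
have -> : fexp F X = x by apply/flimE/filtered_converges.
have -> : x - 1 - X = (x - u t.+2) + \sum_(2 <= m < t.+2) (m`!%:R : R)^-1 *: X ^+ m.
  rewrite /u /series /= (big_cat_nat (n := 2)) //= opprD addrA subrK.
  rewrite [\sum_(0 <= k < 2) _]big_nat_recr //= big_nat1 expr0 expr1 fact0 !invr1.
  by rewrite !scale1r opprD addrA.
apply: filtD; first by apply/filt_sym; apply: filt_le (hx _).
rewrite big_nat_cond; apply: filt_sum => m /andP[/andP[hm _] _]; apply: filt_le (hX' m).
by apply: (leq_trans _ (leq_mul hm (leqnn t))); rewrite mul2n -addnn -addn1 leq_add2l.
Qed.

End Convenient.

Section Units.
Variables (R : realType) (A : unitAlgType R) (F : nat -> set A).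
Hypothesis hF : convenient F.

(** The inverse of [x = 1 - z] is the limit of the Neumann series of [z]. *)
Lemma filt_unit x : F 1%N (x - 1) -> x \is a GRing.unit.
Proof.
move=> hx; pose z := 1 - x; pose u k := \sum_(i < k) z ^+ i.
have hz : F 1%N z by apply: (filt_sym hF).
have hzk k : F k (z ^+ k) by have := filtX hF k hz; rewrite muln1.
have [y hy] : exists y, forall m, F m (u m - y).
  by apply: (filt_cauchy hF) => // m; rewrite /u big_ord_recr /= addrAC subrr add0r.
have xE : x = - (z - 1) by rewrite /z addrC addKr opprK.
have hl k : x * u k - 1 = - z ^+ k.
  by rewrite xE mulNr /u -subrX1 opprB addrAC subrr add0r.
have hr k : u k * x = x * u k.
  apply: commr_sym; apply: commr_sum => i _; apply: commrX.
  by rewrite /z; apply: commrB; [exact: commr1|].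
apply/unitrP; exists y; split; apply: (filt_eq hF) => i.
  have -> : y * x - 1 = (u i * x - 1) - (u i - y) * x.
    by rewrite mulrBl opprB [RHS]addrC addrA subrK.
  by apply: (filtB hF) => //; [rewrite hr hl; exact: filtN|exact: (filtMr hF)].
have -> : x * y - 1 = (x * u i - 1) - x * (u i - y).
  by rewrite mulrBr opprB [RHS]addrC addrA subrK.
by apply: (filtB hF) => //; [rewrite hl; exact: filtN|exact: (filtMl hF)].
Qed.

Local Notation FF := (doubled_filtration F).

Lemma doubled_convenient : convenient FF.
Proof.
split=> //=.
- by apply/seteqP; split=> // x _; split; exact: (filt_total hF).
- by move=> i; split; exact: (filt0 hF).
- by move=> i a x y [h1 h2] [h3 h4]; split; apply: (filtration_linear hF).
- by move=> i x [h1 h2]; split; apply: (filtration_decr hF).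
- move=> i j x y [h1 h2] [h3 h4]; split; first exact: (filtration_mul hF).
  by rewrite addnC; exact: (filtration_mul hF h4 h2).
- apply/seteqP; split=> [[x y] h|_ -> i _]; last by split; exact: (filt0 hF).
  have -> : x = 0 by apply: (filt_separated hF) => i; case: (h i I).
  by have -> : y = 0 by apply: (filt_separated hF) => i; case: (h i I).
- move=> u hu.
  have [i|x hx] := filtration_complete hF (u := fun m => (u m).1).
    by have [N hN] := hu i; exists N => k l hk hl; case: (hN k l hk hl).
  have [i|y hy] := filtration_complete hF (u := fun m => (u m).2 : A).
    by have [N hN] := hu i; exists N => k l hk hl; case: (hN k l hk hl).
  exists ((x, y) : doubled A) => i; have [N hN] := hx i; have [N' hN'] := hy i.
  by exists (maxn N N') => k; rewrite geq_max => /andP[/hN ? /hN' ?]; split.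
- move=> i; have [d [p [hp1 hp2]]] := filtration_findim hF i.
  pose q (Z : doubled A) : 'rV[R]_(d + d) := row_mx (p Z.1) (p (Z.2 : A)).
  have qlin : linear q.
    by move=> a x y; rewrite /q scale_row_mx add_row_mx !linearP.
  pose q' := GRing.isLinear.Build R (doubled A) 'rV[R]_(d + d) *:%R q qlin.
  pose ql : {linear doubled A -> 'rV[R]_(d + d)} := HB.pack q q'.
  exists (d + d)%N, ql; split=> [|Z].
    rewrite -subTset => y _.
    have [a _ ha] : range p (lsubmx y) by rewrite hp1.
    have [b _ hb] : range p (rsubmx y) by rewrite hp1.
    by exists ((a, b) : doubled A) => //; rewrite /= /q /= ha hb hsubmxK.
  rewrite /= /q; split=> [|[/hp2 h1 /hp2 h2]].
    by rewrite -row_mx0 => /eq_row_mx[/hp2 ? /hp2 ?].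
  by rewrite h1 h2 row_mx0.
Qed.

End Units.

(** * Connections on a filtered family of frames *)

Section Geometry.
Variables (R : realType) (A E : algType R) (F : nat -> set A) (G : nat -> set E).
Hypothesis (hF : convenient F) (hG : convenient G).
Variable n : nat.
Local Notation system := ('I_n.+1 -> A).
Variables (P : system -> Prop) (u : E).
Variables (d : system -> 'I_n.+1 -> {linear E -> A}).
Variables (s : system -> 'I_n.+1 -> {linear A -> E}).
Variables (move : E -> system -> system).

Definition rotate (O : 'M[R]_n.+1) (Q : system) : system :=
  fun a => \sum_j O a j *: Q j.

Definition near_systems t (Q Q' : system) : Prop := forall j, F t (Q j - Q' j).

(** What the iteration needs from the two families of frames: [P] selects the
    systems, [d Q] is the infinitesimal action whose exponential form is [move],
    and [u] is the common value of the [s Q j (Q j)]. *)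
Record geometry : Prop := Geometry {
  geo_frame : forall Q, P Q -> frame (d Q) (s Q);
  geo_d : forall Q j i X, G i X -> F i (d Q j X);
  geo_s : forall Q j i Y, F i Y -> G i (s Q j Y);
  geo_dlip : forall Q Q' t j i X, P Q -> P Q' -> near_systems t Q Q' ->
    G i X -> F (t + i) (d Q j X - d Q' j X);
  geo_slip : forall Q Q' t j i Y, P Q -> P Q' -> near_systems t Q Q' ->
    F i Y -> G (t + i) (s Q j Y - s Q' j Y);
  geo_rotate : forall (O : 'M[R]_n.+1) Q, O *m O^T = 1%:M -> P Q ->
    [/\ P (rotate O Q),
        forall a X, d (rotate O Q) a X = \sum_j O a j *: d Q j X
      & forall a Y, s (rotate O Q) a Y = \sum_j O a j *: s Q j Y];
  geo_base : forall Q j, P Q -> s Q j (Q j) = u;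
  geo_rigid : forall Q Q' t, (0 < t)%N -> P Q -> P Q' -> near_systems t Q' Q ->
    exists X, G t X /\ near_systems t.+1 (fun j => Q' j - Q j) (fun j => d Q j X);
  geo_move : forall Q X, P Q -> G 1 X -> P (move X Q);
  geo_approx : forall Q X t, (0 < t)%N -> P Q -> G t X ->
    near_systems t.+1 (fun j => move X Q j - Q j) (fun j => d Q j X);
  geo_closed : forall (Qs : nat -> system) Q,
    (forall m, P (Qs m)) -> (forall m, near_systems m.+1 (Qs m) Q) -> P Q }.

Hypothesis geo : geometry.

Lemma reflection_filtered Q j i X : G i X -> G i (reflection (d Q) (s Q) j X).
Proof.
by move=> h; apply: (filtB hG) => //; apply: (geo_s geo); apply: (geo_d geo).
Qed.

Lemma fparts_filtered Q iota i X : G i X -> G i (fparts (d Q) (s Q) iota X).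
Proof.
rewrite /fparts; elim: (enum _) X => [//|j r IH] X hX.
rewrite eigenparts_cons; apply: IH; rewrite /eigenpart; apply: (filtZ hG).
have hr := reflection_filtered Q j hX.
by case: (iota j); [exact: (filtB hG)|exact: (filtD hG)].
Qed.

(** Telescoping: change [X] first, then [d], then [s]. *)
Lemma sd_lip Q Q' t j i X X' : P Q -> P Q' -> near_systems t Q Q' ->
  G i X' -> G (t + i) (X - X') ->
  G (t + i) (s Q j (d Q j X) - s Q' j (d Q' j X')).
Proof.
move=> hQ hQ' hQQ' hX' hXX'.
apply: (filt_trans hG (y := s Q j (d Q' j X'))).
  rewrite -linearB; apply: (geo_s geo); apply: (filt_trans hF (y := d Q j X')).
    by rewrite -linearB; exact: (geo_d geo).
  exact: (geo_dlip geo).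
by apply: (geo_slip geo) => //; exact: (geo_d geo).
Qed.

Lemma fparts_lip Q Q' t iota i X X' : P Q -> P Q' -> near_systems t Q Q' ->
  G i X -> G i X' -> G (t + i) (X - X') ->
  G (t + i) (fparts (d Q) (s Q) iota X - fparts (d Q') (s Q') iota X').
Proof.
move=> hQ hQ' hQQ'; rewrite /fparts; elim: (enum _) X X' => [//|j r IH] X X' hX hX' hXX'.
have hr := reflection_filtered Q j hX; have hr' := reflection_filtered Q' j hX'.
have hrr : G (t + i) (reflection (d Q) (s Q) j X - reflection (d Q') (s Q') j X').
  rewrite /reflection opprD addrACA; apply: (filtD hG) => //.
  by rewrite -opprD; apply/(filtN hG)/sd_lip.
rewrite !eigenparts_cons; apply: IH; rewrite /eigenpart.
- by apply: (filtZ hG); case: (iota j); [exact: (filtB hG)|exact: (filtD hG)].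
- by apply: (filtZ hG); case: (iota j); [exact: (filtB hG)|exact: (filtD hG)].
rewrite -scalerBr; apply: (filtZ hG); case: (iota j).
  by rewrite [- (X' - _)]opprD addrACA -opprD; exact: (filtB hG).
by rewrite [- (X' + _)]opprD addrACA; exact: (filtD hG).
Qed.

(** A filtered, Lipschitz left inverse of [X |-> (d Q j X)_j] on the tangent
    space, normalized at [B = Q]. *)
Record connection_map (pi : system -> system -> E) : Prop := ConnectionMap {
  pi_B : forall Q B B', P Q -> pi Q (fun j => B j - B' j) = pi Q B - pi Q B';
  pi_filtered : forall Q B i, P Q -> (forall j, F i (B j)) -> G i (pi Q B);
  pi_lip : forall Q Q' B t i, P Q -> P Q' -> near_systems t Q Q' ->
    (forall j, F i (B j)) -> G (t + i) (pi Q B - pi Q' B);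
  pi_tangent : forall Q B, P Q -> fixed_part (d Q) (s Q) (pi Q B) = 0;
  pi_d : forall Q X, P Q ->
    pi Q (fun j => d Q j X) = X - fixed_part (d Q) (s Q) X;
  pi_base : forall Q, P Q -> pi Q Q = 2^-1 *: u }.

Lemma projection_connection w pi : weights w ->
  (forall Q B, P Q -> pi Q B = projection (d Q) (s Q) w B) ->
  connection_map pi.
Proof.
move=> hw hpi; split=> [Q B B' hQ|Q B i hQ hB|Q Q' B t i hQ hQ' hQQ' hB|Q B hQ|Q X hQ|Q hQ].
- rewrite !hpi // /projection -scalerBr -sumrB; congr (_ *: _).
  apply: eq_bigr => j _; rewrite -sumrB; apply: eq_bigr => iota _.
  by rewrite linearB [fparts _ _ _ _]linearB scalerBr.
- rewrite hpi //; apply/(filtZ hG)/(filt_sum hG) => j _; apply/(filt_sum hG) => iota _.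
  by apply/(filtZ hG)/fparts_filtered/(geo_s geo).
- rewrite !hpi // /projection -scalerBr -sumrB; apply/(filtZ hG)/(filt_sum hG) => j _.
  rewrite -sumrB; apply/(filt_sum hG) => iota _; rewrite -scalerBr; apply/(filtZ hG).
  by apply: fparts_lip => //; [exact: (geo_s geo)|exact: (geo_s geo)|exact: (geo_slip geo)].
- by rewrite hpi //; apply: fixed_part_projection => //; exact: (geo_frame geo).
- by rewrite hpi //; apply: projection_d => //; exact: (geo_frame geo).
- rewrite hpi //; apply: (projection_const (geo_frame geo hQ) ord0 hw) => j.
  exact: (geo_base geo).
Qed.

(** The tangent space does not change under rotation, and the infinitesimal action
    on the rotated system is the rotated infinitesimal action. *)
Lemma rotated_connection (O : 'M[R]_n.+1) pi : O *m O^T = 1%:M ->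
  connection_map pi ->
  connection_map (fun Q B => pi (rotate O Q) (rotate O B)).
Proof.
move=> hO hpi; have hP Q : P Q -> P (rotate O Q) by move=> /(geo_rotate geo hO)[].
have rotB B B' : rotate O (fun j => B j - B' j) = (fun j => rotate O B j - rotate O B' j).
  by apply/funext => a; rewrite /rotate -sumrB; apply: eq_bigr => j _; rewrite scalerBr.
have rotF B i : (forall j, F i (B j)) -> forall a, F i (rotate O B a).
  by move=> hB a; apply: (filt_sum hF) => j _; exact: (filtZ hF).
have fixE Q X : P Q -> fixed_part (d (rotate O Q)) (s (rotate O Q)) X
    = fixed_part (d Q) (s Q) X.
  move=> hQ; have [hQ' hd hs] := geo_rotate geo hO hQ.
  exact: (fixed_part_rotation hO hd hs (geo_frame geo hQ) (geo_frame geo hQ')).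
split=> [Q B B' hQ|Q B i hQ hB|Q Q' B t i hQ hQ' hQQ' hB|Q B hQ|Q X hQ|Q hQ].
- by rewrite rotB (pi_B hpi) //; exact: hP.
- by apply: (pi_filtered hpi); [exact: hP|exact: rotF].
- apply: (pi_lip hpi); [exact: hP|exact: hP| |exact: rotF].
  by move=> a; have := rotF (fun j => Q j - Q' j) t hQQ' a; rewrite rotB.
- by rewrite -fixE // (pi_tangent hpi) //; exact: hP.
- rewrite -fixE // -(pi_d hpi) //; last exact: hP.
  congr (pi _ _); apply/funext => a.
  by have [_ -> _] := geo_rotate geo hO hQ.
- by rewrite (pi_base hpi) //; exact: hP.
Qed.

(** The hypothesis on [pi] only says that it picks the tangent solution of the
    equation of the metric whenever this solution is unique. *)
Lemma metric_connection (eta : 'M[R]_n.+1) pi : positive_definite eta ->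
  (forall Q B X, P Q -> fixed_part (d Q) (s Q) X = 0 ->
    \sum_i \sum_j eta i j *: s Q i (d Q j X) = \sum_i \sum_j eta i j *: s Q i (B j) ->
    (forall Z, fixed_part (d Q) (s Q) Z = 0 ->
      \sum_i \sum_j eta i j *: s Q i (d Q j Z) = 0 -> Z = 0) ->
    pi Q B = X) ->
  connection_map pi.
Proof.
move=> [etaT eta0] hpi.
have [U [D [hO D0 etaE]]] := positive_definite_diagonalization etaT eta0.
have hw := diag_weightsP D0.
have := rotated_connection hO (projection_connection hw (fun Q B _ => erefl)).
set pi' := (X in connection_map X) => hpi'.
have piE Q B : P Q -> pi Q B = pi' Q B.
  move=> hQ; have hf := geo_frame geo hQ.
  have [hQ' hd hs] := geo_rotate geo hO hQ; have hf' := geo_frame geo hQ'.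
  apply: hpi => //.
  - exact: (pi_tangent hpi').
  - exact: (metric_solution hd hs hf' D0 etaE).
  - by move=> Z; exact: (metric_inj hO hd hs hf hf' D0 etaE).
split=> [Q B B' hQ|Q B i hQ hB|Q Q' B t i hQ hQ' hQQ' hB|Q B hQ|Q X hQ|Q hQ].
- by rewrite !piE //; exact: (pi_B hpi').
- by rewrite piE //; exact: (pi_filtered hpi').
- by rewrite !piE //; exact: (pi_lip hpi').
- by rewrite piE //; exact: (pi_tangent hpi').
- by rewrite piE //; exact: (pi_d hpi').
- by rewrite piE //; exact: (pi_base hpi').
Qed.

(** Each condition is an equality of limits or membership in a closed level of the
    filtration. *)
Lemma limit_connection (pis : nat -> system -> system -> E) pi :
  (forall m, connection_map (pis m)) ->
  (forall Q B, P Q -> converges G (fun m => pis m Q B) (pi Q B)) ->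
  connection_map pi.
Proof.
move=> hpis hpi.
have lim_cst Q B X : P Q -> (forall m, pis m Q B = X) -> pi Q B = X.
  move=> hQ hX; apply: (converges_unique hG (hpi Q B hQ)).
  by under [X in converges _ X _]funext do rewrite hX; exact: (converges_cst hG).
split=> [Q B B' hQ|Q B i hQ hB|Q Q' B t i hQ hQ' hQQ' hB|Q B hQ|Q X hQ|Q hQ].
- apply: (converges_unique hG (hpi _ _ hQ)).
  have -> : (fun m => pis m Q (fun j => B j - B' j))
      = (fun m => pis m Q B - pis m Q B').
    by apply/funext => m; exact: (pi_B (hpis m)).
  by apply: convergesB; exact: hpi.
- apply: (converges_closed hG _ (hpi Q B hQ)) => m.
  exact: (pi_filtered (hpis m)).
- apply: (converges_closed hG _ (convergesB (hpi Q B hQ) (hpi Q' B hQ'))) => m.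
  exact: (pi_lip (hpis m)).
- have hf := geo_frame geo hQ.
  have := converges_idempotent hG (e := fixed_part (d Q) (s Q)) (fixed_part_idem hf)
    (fun i X => @fparts_filtered Q _ i X) (hpi Q B hQ).
  move=> h; apply: (converges_unique hG h).
  have -> : (fun m => fixed_part (d Q) (s Q) (pis m Q B)) = (fun=> 0).
    by apply/funext => m; exact: (pi_tangent (hpis m)).
  exact: (converges_cst hG).
- by apply: lim_cst => // m; exact: (pi_d (hpis m)).
- by apply: lim_cst => // m; exact: (pi_base (hpis m)).
Qed.

(** * The iteration *)

Section Iteration.
Variable pi : system -> system -> E.
Hypothesis hpi : connection_map pi.

(** The Newton step: [pi Q] takes the displacement [Q' - Q] to [X] up to an error of
    level [t + 1], and replacing [pi Q] by [pi Q'] on the level 1 system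
    [B - Q'] introduces an error of the same level. *)
Lemma pi_step B Q t (X := pi Q (fun j => B j - Q j)) (Q' := move X Q) :
  P Q -> near_systems 1 B Q -> (0 < t)%N -> G t X ->
  [/\ P Q', near_systems t Q' Q, near_systems 1 B Q'
    & G t.+1 (pi Q' (fun j => B j - Q' j))].
Proof.
move=> hQ hBQ t0 hX.
have hQ' : P Q' by apply: (geo_move geo) => //; apply: (filt_le hG) hX.
have hr := geo_approx geo t0 hQ hX.
have hD : near_systems t Q' Q.
  move=> j; rewrite -[Q' j - Q j](subrK (d Q j X)); apply: (filtD hF).
    exact: (filt_le hF (leqnSn t) (hr j)).
  exact: (geo_d geo).
have hBQ' : near_systems 1 B Q'.
  by move=> j; apply: (filt_trans hF (hBQ j)); apply/(filt_sym hF)/(filt_le hF t0)/hD.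
split=> //.
pose r j := (Q' j - Q j) - d Q j X.
have -> : pi Q' (fun j => B j - Q' j) =
    (pi Q' (fun j => B j - Q' j) - pi Q (fun j => B j - Q' j)) - pi Q r.
  have -> : pi Q r = - pi Q (fun j => B j - Q' j).
    have -> : r = (fun j => ((B j - Q j) - (B j - Q' j)) - d Q j X).
      by apply/funext => j; rewrite opprB [_ + (Q' j - B j)]addrC addrA subrK.
    rewrite (pi_B hpi) // (pi_B hpi) // (pi_d hpi) // (pi_tangent hpi) // subr0 -/X.
    by rewrite addrAC subrr add0r.
  by rewrite opprK subrK.
apply: (filtB hG); last exact: (pi_filtered hpi).
by rewrite -addn1; apply: (pi_lip hpi).
Qed.

Lemma pi_split B Q : P Q -> pi Q B = pi Q (fun j => B j - Q j) + 2^-1 *: u.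
Proof. by move=> hQ; rewrite (pi_B hpi) // (pi_base hpi) // subrK. Qed.

(** If the two systems agree up to level [t], their difference is [d X] up to level
    [t + 1] with [X] tangent; applying [pi Q] shows that [X] itself has level
    [t + 1]. *)
Lemma pi_unique B Q Q' : P Q -> P Q' -> near_systems 1 B Q -> near_systems 1 B Q' ->
  pi Q B = 2^-1 *: u -> pi Q' B = 2^-1 *: u -> Q' = Q.
Proof.
move=> hQ hQ' hBQ hBQ' h h'.
have p0 : pi Q (fun j => B j - Q j) = 0.
  by apply: (addIr (2^-1 *: u)); rewrite add0r -pi_split.
have p0' : pi Q' (fun j => B j - Q' j) = 0.
  by apply: (addIr (2^-1 *: u)); rewrite add0r -pi_split.
suff hn t : near_systems t.+1 Q' Q.
  by apply/funext => j; apply: (filt_eq hF) => i; apply: (filt_le hF (leqnSn i)); exact: hn.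
elim: t => [|t IH].
  by move=> j; apply: (filt_trans hF _ (hBQ j)); exact: (filt_sym hF).
have [X [hX hr]] := geo_rigid geo (ltn0Sn t) hQ hQ' IH.
pose r j := (Q' j - Q j) - d Q j X.
pose X0 := X - fixed_part (d Q) (s Q) X.
have hX0 : G t.+2 X0.
  have -> : X0 = - (pi Q (fun j => B j - Q' j) - pi Q' (fun j => B j - Q' j)) - pi Q r.
    have -> : pi Q r = - pi Q (fun j => B j - Q' j) - pi Q (fun j => d Q j X).
      rewrite -[- pi Q _]sub0r -p0 -!(pi_B hpi) //; congr (pi _ _).
      by apply/funext => j; rewrite opprB [_ + (Q' j - B j)]addrC addrA subrK.
    by rewrite p0' subr0 (pi_d hpi) // opprB [RHS]addrC subrK.
  apply: (filtB hG); last exact: (pi_filtered hpi).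
  apply: (filtN hG); rewrite -addn1; apply: (pi_lip hpi) => // j.
  exact: (filt_sym hF).
move=> j; rewrite -[Q' j - Q j](subrK (d Q j X)); apply: (filtD hF); first exact: hr.
have -> : d Q j X = d Q j X0.
  by rewrite linearB /= (d_fixed_part (geo_frame geo hQ)) subr0.
exact: (geo_d geo).
Qed.

Theorem iteration_limit B Q
  (Qs := fun m => iter m (fun Q' => move (pi Q' (fun j => B j - Q' j)) Q') Q) :
  P Q -> near_systems 1 B Q ->
  exists Qlim : system,
    [/\ forall j, converges F (fun m => Qs m j) (Qlim j),
        forall m j, F m.+1 (Qs m j - Qlim j),
        P Qlim,
        pi Qlim B = 2^-1 *: u /\ (forall j, F 1%N (B j - Qlim j))
      & forall Q', P Q' -> pi Q' B = 2^-1 *: u ->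
          (forall j, F 1%N (B j - Q' j)) -> Q' = Qlim].
Proof.
move=> hQ hBQ.
have inv m : [/\ P (Qs m), near_systems 1 B (Qs m)
    & G m.+1 (pi (Qs m) (fun j => B j - Qs m j))].
  elim: m => [|m [h1 h2 h3]]; first by split=> //; exact: (pi_filtered hpi).
  by have [? _ ? ?] := pi_step h1 h2 (ltn0Sn m) h3; split.
have hstep m j : F m.+1 (Qs m.+1 j - Qs m j).
  have [h1 h2 h3] := inv m.
  by have [_ /(_ j) ? _ _] := pi_step h1 h2 (ltn0Sn m) h3.
have /choice[Ql hl] j : exists x, forall m, F m (Qs m j - x).
  by apply: (filt_cauchy hF) => m; apply: (filt_le hF (leqnSn m)).
have hlim m j : F m.+1 (Qs m j - Ql j).
  by apply: (filt_trans hF (filt_sym hF (hstep m j))); exact: hl.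
have hPl : P Ql by apply: (geo_closed geo (Qs := Qs)) => m; [case: (inv m)|exact: hlim].
have hBl : near_systems 1 B Ql by move=> j; apply: (filt_trans hF (hBQ j)); exact: (hlim 0%N).
have hpil : pi Ql B = 2^-1 *: u.
  rewrite pi_split // -[RHS]add0r; congr (_ + _); apply: (filt_separated hG) => i.
  have [h1 h2 h3] := inv i.
  have -> : pi Ql (fun j => B j - Ql j) =
      (pi Ql (fun j => B j - Ql j) - pi (Qs i) (fun j => B j - Ql j))
      + (pi (Qs i) (fun j => B j - Qs i j) + pi (Qs i) (fun j => Qs i j - Ql j)).
    rewrite -[X in X + _]opprB addrC.
    have -> : pi (Qs i) (fun j => Qs i j - Ql j) =
        pi (Qs i) (fun j => B j - Ql j) - pi (Qs i) (fun j => B j - Qs i j).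
      rewrite -(pi_B hpi) //; congr (pi _ _); apply/funext => j.
      by rewrite opprB [RHS]addrC addrA subrK.
    by rewrite [_ + (pi _ _ - pi _ (fun j => B j - Qs i j))]addrC subrK opprB addrC subrK.
  apply: (filtD hG).
    apply: (filt_le hG (leq_addr 1 i)); apply: (pi_lip hpi) => // j.
    exact/(filt_sym hF)/hl.
  apply: (filtD hG); first exact: (filt_le hG (leqnSn i) h3).
  by apply: (pi_filtered hpi) => // j; exact: hl.
exists Ql; split=> //.
  by move=> j; apply: (filtered_converges hF) => m; exact: hl.
by move=> Q' hQ' hp hB'; exact: (pi_unique hPl hQ' hBl hB' hpil hp).
Qed.

End Iteration.
End Geometry.

(** * Clifford systems *)

Section Products.
Variables (R : realType) (A : unitAlgType R) (F : nat -> set A).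
Hypothesis hF : convenient F.

Lemma filt_mulB t x x' y y' : F t (x - x') -> F t (y - y') -> F t (x * y - x' * y').
Proof.
move=> hx hy; apply: (filt_trans hF (y := x * y')).
  by rewrite -mulrBr; exact: (filtMl hF).
by rewrite -mulrBl; exact: (filtMr hF).
Qed.

Lemma filt_invB t x x' : x \is a GRing.unit -> x' \is a GRing.unit ->
  F t (x - x') -> F t (x^-1 - x'^-1).
Proof.
move=> ux ux' h; have -> : x^-1 - x'^-1 = x^-1 * (x' - x) * x'^-1.
  by rewrite mulrBr mulVr // mulrBl mulrK // mul1r.
by apply/(filtMr hF)/(filtMl hF)/(filt_sym hF).
Qed.

Lemma exponential_unit X : F 1%N X -> fexp F X \is a GRing.unit.
Proof.
move=> hX; apply: (filt_unit hF); rewrite -[_ - 1](subrK X); apply: (filtD hF) => //.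
by apply: (filt_le hF (leqnSn 1)); exact: (exponential_approx hF).
Qed.

Lemma exponential_near X t : (0 < t)%N -> F t X -> F t (fexp F X - 1).
Proof.
move=> t0 hX; rewrite -[_ - 1](subrK X); apply: (filtD hF) => //.
by apply: (filt_le hF (leqnSn t)); exact: (exponential_approx hF).
Qed.

(** The identity is polarized, so orthogonality of the rotation preserves it.  For
    [X = Y = Q] it is the Clifford relation; for [X] a floating system and [Y] its
    inverse it is the floating one. *)
Lemma rotated_relation n (U : 'M[R]_n.+1) (X Y : 'I_n.+1 -> A) (c : A) :
  U *m U^T = 1%:M ->
  (forall i j, X i * Y j + X j * Y i = c * (i == j)%:R) ->
  forall a b, rotate U X a * rotate U Y b + rotate U X b * rotate U Y a
    = c * (a == b)%:R.
Proof.
move=> hO hXY a b.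
have prodE a' b' : rotate U X a' * rotate U Y b'
    = \sum_i \sum_j (U a' i * U b' j) *: (X i * Y j).
  rewrite /rotate mulr_suml; apply: eq_bigr => i _; rewrite mulr_sumr.
  by apply: eq_bigr => j _; rewrite -scalerAl -scalerAr scalerA.
rewrite !prodE [X in _ + X]exchange_big -big_split /=.
have -> : \sum_i (\sum_j (U a i * U b j) *: (X i * Y j)
      + \sum_j (U b j * U a i) *: (X j * Y i))
    = \sum_i (U a i * U b i) *: c.
  apply: eq_bigr => i _; rewrite -big_split (bigD1 i) //= big1 => [|j hj].
    by rewrite [U b i * _]mulrC -scalerDr hXY eqxx mulr1 addr0.
  by rewrite [U b j * _]mulrC -scalerDr hXY eq_sym (negbTE hj) mulr0 scaler0.
have UU : \sum_i U a i * U b i = (a == b)%:R.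
  have /matrixP/(_ a b) := hO; rewrite !mxE => <-.
  by apply: eq_bigr => i _; rewrite mxE.
by rewrite -scaler_suml UU scaler_nat mulr_natr.
Qed.

End Products.

Section CliffordSystems.
Variables (R : realType) (A : unitAlgType R).

Lemma double_inj (x y : A) : x + x = y + y -> x = y.
Proof. by move=> h; rewrite -[x](@half_double R) h half_double. Qed.

Variables (n : nat) (Q : 'I_n -> A).
Hypothesis hQ : clifford Q.

Lemma clifford_sqr i : Q i * Q i = - 1.
Proof.
by apply: double_inj; rewrite hQ eqxx mulr1 -opprD.
Qed.

Lemma clifford_unit i : Q i \is a GRing.unit.
Proof.
by apply/unitrP; exists (- Q i); rewrite mulNr mulrN clifford_sqr opprK.
Qed.

Lemma clifford_inv i : (Q i)^-1 = - Q i.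
Proof.
apply: (mulIr (clifford_unit i)).
by rewrite mulVr ?clifford_unit // mulNr clifford_sqr opprK.
Qed.

Lemma clifford_anti i j : i != j -> Q i * Q j = - (Q j * Q i).
Proof.
by move=> hij; apply/eqP; rewrite -addr_eq0 hQ (negbTE hij) mulr0.
Qed.

End CliffordSystems.

Section Intertwiner.
Variables (R : realType) (A : unitAlgType R) (n : nat) (Q Q' : 'I_n -> A).
Hypothesis (hQ : clifford Q) (hQ' : clifford Q').

(** The mean over the subgroup generated by index [i] of the twisted action
    [S |-> Q'_i S Q_i^-1], where [Q_i^-1 = - Q_i]. *)
Definition average i (S : A) : A := 2^-1 *: (S - Q' i * S * Q i).

Lemma average_intertwines i S : Q' i * average i S = average i S * Q i.
Proof.
rewrite /average -scalerAr -scalerAl mulrBr mulrBl !mulrA clifford_sqr //.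
by rewrite mulN1r mulNr -[X in _ = _ *: (_ - X)]mulrA clifford_sqr // mulrN1 !opprK addrC.
Qed.

(** The twisted actions of two indices commute, as the two signs coming from
    anticommutation cancel. *)
Lemma average_preserves i j S : Q' j * S = S * Q j ->
  Q' j * average i S = average i S * Q j.
Proof.
move=> h; have [->|hij] := eqVneq j i; first exact: average_intertwines.
rewrite /average -scalerAr -scalerAl mulrBr mulrBl h !mulrA; congr (_ *: (_ - _)).
rewrite (clifford_anti hQ' hij) !mulNr -[Q' i * Q' j * S]mulrA h.
by rewrite -!mulrA (clifford_anti hQ hij) !mulrN opprK.
Qed.

Definition intertwiner : A := foldl (fun S i => average i S) 1 (enum 'I_n).

Lemma intertwinerP i : Q' i * intertwiner = intertwiner * Q i.
Proof.
have : i \in enum 'I_n by rewrite mem_enum.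
rewrite /intertwiner; elim: (enum _) 1 => [//|j r IH] S /=.
rewrite inE => /orP[/eqP<-|]; last exact: IH.
move: (average_intertwines i S); elim: r (average i S) {IH} => [//|k r IH] T h /=.
exact/IH/average_preserves.
Qed.

Lemma intertwiner_near (F : nat -> set A) t : convenient F ->
  (forall i, F t (Q' i - Q i)) -> F t (intertwiner - 1).
Proof.
move=> hF h; rewrite /intertwiner.
have : F t (1 - 1 : A) by rewrite subrr; exact: (filt0 hF).
elim: (enum _) {1 3}1 => [//|j r IH] S hS /=; apply: IH.
have -> : average j S - 1 = 2^-1 *: ((S - 1) - (Q' j * S * Q j - Q j * 1 * Q j)).
  rewrite mulr1 clifford_sqr // opprK opprD addrACA -opprD scalerDr scalerN half_double.
  by rewrite /average.
apply/(filtZ hF)/(filtB hF) => //; apply: (filt_mulB hF); last by rewrite subrr; exact: (filt0 hF).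
exact: (filt_mulB hF).
Qed.

End Intertwiner.

Section CliffordGeometry.
Variables (R : realType) (A : unitAlgType R) (F : nat -> set A).
Hypothesis hF : convenient F.
Variable n : nat.
Local Notation system := ('I_n.+1 -> A).
Implicit Type Q : system.

Definition ad Q j (X : A) : A := commutator X (Q j).
(** The factor makes [coad Q j (ad Q j X)] equal to [X - Q_j X Q_j^-1], so that the
    reflection of this frame is the conjugation by [Q_j]. *)
Definition coad Q j (Y : A) : A := (- 2^-1 : R) *: commutator Y (Q j).

Lemma ad_is_linear Q j : linear (ad Q j).
Proof.
move=> a X Y; rewrite /ad /commutator mulrDl mulrDr -scalerAl -scalerAr.
by rewrite opprD addrACA -scalerBr.
Qed.

HB.instance Definition _ Q j :=
  GRing.isLinear.Build R A A *:%R (ad Q j) (@ad_is_linear Q j).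

Lemma coad_is_linear Q j : linear (coad Q j).
Proof.
move=> a X Y; rewrite /coad -!/(ad Q j _) linearP scalerDr !scalerA.
by rewrite [_ * a]mulrC.
Qed.

HB.instance Definition _ Q j :=
  GRing.isLinear.Build R A A *:%R (coad Q j) (@coad_is_linear Q j).

Let d Q j : {linear A -> A} := ad Q j.
Let s Q j : {linear A -> A} := coad Q j.

Lemma coad_ad Q j X : clifford Q -> coad Q j (ad Q j X) = X + Q j * X * Q j.
Proof.
move=> hQ; rewrite /coad; set Y := _ + _.
have -> : commutator (ad Q j X) (Q j) = - (Y + Y).
  rewrite /ad /commutator mulrBl mulrBr !mulrA clifford_sqr // -[X * _ * _]mulrA.
  by rewrite clifford_sqr // mulrN1 mulNr mul1r opprK [_ + X]addrC -!opprD.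
by rewrite scaleNr scalerN opprK half_double.
Qed.

Lemma clifford_reflection Q j X : clifford Q ->
  reflection (d Q) (s Q) j X = - (Q j * X * Q j).
Proof. by move=> hQ; rewrite /reflection /= coad_ad // opprD addNKr. Qed.

Lemma ad_conj Q j X : clifford Q -> Q j * ad Q j X * Q j = ad Q j X.
Proof.
move=> hQ; rewrite /ad /commutator mulrBr mulrBl !mulrA clifford_sqr //.
by rewrite mulN1r mulNr -[Q j * X * _ * _]mulrA clifford_sqr // mulrN1 opprK addrC.
Qed.

Lemma clifford_frame Q : clifford Q -> frame (d Q) (s Q).
Proof.
move=> hQ; split=> [j Y|j X|i j X] /=.
- rewrite coad_ad // /coad -!scalerAr -scalerAl.
  by rewrite -[commutator Y (Q j)]/(ad Q j Y) ad_conj.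
- rewrite coad_ad // linearD /=; congr (_ + _).
  rewrite -[RHS]ad_conj // /ad /commutator mulrBr mulrBl !mulrA.
  by [].
- rewrite !clifford_reflection // !mulrN !mulNr !opprK !mulrA.
  have [->//|hij] := eqVneq i j.
  rewrite (clifford_anti hQ hij) !mulNr -!mulrA.
  by rewrite [Q j * Q i](clifford_anti hQ) 1?eq_sym // !mulrN opprK.
Qed.

(** For rigidity, an intertwiner [S] of level [t] near 1 satisfies
    [Q' - Q - [S - 1, Q] = - (Q' - Q) (S - 1)], which has level [2 t]. *)
Lemma clifford_geometry :
  geometry F F (@clifford R A n.+1) 0 d s (fun X Q => Ad (fexp F X) Q).
Proof.
split.
- exact: clifford_frame.
- by move=> Q j i X hX; apply: (filtB hF); [exact: (filtMr hF)|exact: (filtMl hF)].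
- by move=> Q j i X hX; apply/(filtZ hF)/(filtB hF); [exact: (filtMr hF)|exact: (filtMl hF)].
- move=> Q Q' t j i X _ _ hQQ' hX.
  have -> : d Q j X - d Q' j X = X * (Q j - Q' j) - (Q j - Q' j) * X.
    by rewrite /= /ad /commutator mulrBr mulrBl opprD addrACA -opprD.
  apply: (filtB hF); first by rewrite addnC; exact: (filtration_mul hF).
  exact: (filtration_mul hF).
- move=> Q Q' t j i X _ _ hQQ' hX.
  have -> : s Q j X - s Q' j X
      = (- 2^-1 : R) *: (X * (Q j - Q' j) - (Q j - Q' j) * X).
    by rewrite /= /coad /commutator -scalerBr mulrBr mulrBl opprD addrACA -opprD.
  apply/(filtZ hF)/(filtB hF); first by rewrite addnC; exact: (filtration_mul hF).
  exact: (filtration_mul hF).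
- move=> O Q hO hQ.
  have hd a X : ad (rotate O Q) a X = \sum_j O a j *: ad Q j X.
    rewrite /ad /commutator /rotate mulr_sumr mulr_suml -sumrB.
    by apply: eq_bigr => j _; rewrite -scalerAr -scalerAl scalerBr.
  split=> // [|a X]; first exact: (rotated_relation hO hQ).
  rewrite /= /coad -/(ad _ _ _) hd scaler_sumr; apply: eq_bigr => j _.
  by rewrite !scalerA mulrC.
- by move=> Q j hQ; rewrite /= /coad /commutator subrr scaler0.
- move=> Q Q' t t0 hQ hQ' hQQ'; pose S := intertwiner Q Q'.
  have hS : F t (S - 1) by apply: intertwiner_near.
  exists (S - 1); split=> // j.
  have -> : Q' j - Q j - d Q j (S - 1) = - ((Q' j - Q j) * (S - 1)).
    rewrite /= /ad /commutator mulrBl mulrBr mul1r mulr1.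
    rewrite -[S * Q j](intertwinerP hQ hQ') [in RHS]mulrBr mulr1 mulrBl !opprB.
    by congr (_ + _); rewrite addrA subrK.
  apply: (filtN hF); apply: (filt_le hF _ (filtration_mul hF (hQQ' j) hS)).
  by rewrite -addn1 leq_add2l.
- move=> Q X hQ hX i j; have ue := exponential_unit hF hX.
  rewrite /Ad !mulrA !mulrVK // -!mulrDl -!(mulrA (fexp F X)) -mulrDr hQ.
  by case: (i == j); rewrite ?mulr0 ?mul0r // !mulr1 mulrN mulNr mulr_natr mulrnAl divrr.
- move=> Q X t t0 hQ hX j; set e := fexp F X.
  have ue : e \is a GRing.unit by apply/(exponential_unit hF)/(filt_le hF t0).
  have he : F t (e - 1) by apply: exponential_near.
  pose r := e - 1 - X; have hr : F t.+1 r by apply: (exponential_approx hF).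
  have -> : Ad e Q j - Q j - d Q j X
      = ad Q j X * (e^-1 - 1) + ad Q j r * e^-1.
    have -> : ad Q j r = e * Q j - Q j * e - ad Q j X.
      rewrite -[ad Q j r]/(d Q j r) /r 2!linearB /=; congr (_ - _).
      by rewrite /ad /commutator mul1r mulr1 subrr subr0.
    rewrite mulrBr mulr1 [(_ - ad Q j X) / e]mulrBl [(e * Q j - _) / e]mulrBl mulrK //.
    by rewrite /Ad /= [RHS]addrC addrA subrK.
  apply: (filtD hF).
    have h1 : F t (e^-1 - 1).
      by rewrite -[X in _ - X]invr1; apply: (filt_invB hF); rewrite ?unitr1.
    have h2 : F t (ad Q j X) by apply: (filtB hF); [exact: (filtMr hF)|exact: (filtMl hF)].
    by apply: (filt_le hF _ (filtration_mul hF h2 h1)); rewrite -addn1 leq_add2l.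
  by apply/(filtMr hF)/(filtB hF); [exact: (filtMr hF)|exact: (filtMl hF)].
- move=> Qs Q hQs hQ i j; apply: (filt_eq hF) => m; rewrite -(hQs m i j).
  apply: (filt_le hF (leqnSn m)); apply: (filt_sym hF).
  rewrite opprD addrACA; apply: (filtD hF); apply: (filt_mulB hF); exact: hQ.
Qed.

End CliffordGeometry.

(** * Connections at a Clifford system *)
Lemma pinv_eq (T : Type) (x0 : T) (S : set T) (U : Type) (f : T -> U) (x : T) (y : U) :
  S x -> f x = y -> (forall z z', S z -> S z' -> f z = f z' -> z = z') ->
  'pinv_(fun=> x0) S f y = x.
Proof.
move=> hx <- inj; apply: pinvKV; last by rewrite inE.
by move=> z z'; rewrite !inE; exact: inj.
Qed.

Section Partition.
Variables (R : realType) (A : unitAlgType R) (n : nat) (Q : 'I_n -> A).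

Lemma parts_eigenparts (c : 'I_n -> {linear A -> A}) (iota iota' : 'I_n -> bool) X :
  (forall i X, c i X = (Q i)^-1 * X * Q i) -> iota =1 iota' ->
  parts iota Q X = eigenparts c iota' (enum 'I_n) X.
Proof.
move=> hc hi; rewrite /parts /eigenparts; elim: (enum _) X => [//|j r IH] X /=.
by rewrite IH /part /eigenpart hc hi.
Qed.

End Partition.

Section CliffordConnections.
Variables (R : realType) (A : unitAlgType R) (F : nat -> set A).
Hypothesis hF : convenient F.
Variable n : nat.
Local Notation system := ('I_n.+1 -> A).
Let d (Q : system) j : {linear A -> A} := ad Q j.
Let s (Q : system) j : {linear A -> A} := coad Q j.
Implicit Types Q B : system.

Lemma clifford_parts Q (iota iota' : 'I_n.+1 -> bool) X : clifford Q -> iota =1 iota' ->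
  parts iota Q X = fparts (d Q) (s Q) iota' X.
Proof.
move=> hQ; apply: parts_eigenparts => i Y.
by rewrite clifford_inv // !mulNr -clifford_reflection.
Qed.

Lemma tangentE Q X : clifford Q -> tangent Q X <-> fixed_part (d Q) (s Q) X = 0.
Proof.
move=> hQ; rewrite /tangent /= (clifford_parts (iota' := [ffun=> false]) X hQ) //.
by move=> i; rewrite ffunE.
Qed.

(** Where [iota j] holds, [(B_j Q_j^-1)^iota] depends only on the part of
    [B_j Q_j^-1] odd under the conjugation by [Q_j], which is [coad Q j (B j)]. *)
Lemma Pi_coefE w Q B : clifford Q -> weights w ->
  Pi_coef w Q B = projection (d Q) (s Q) w B.
Proof.
move=> hQ [w0 _]; congr (_ *: _); apply: eq_bigr => j _; apply: eq_bigr => iota _.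
case hj: (iota j); last by rewrite w0 // !scale0r.
congr (_ *: _); rewrite (clifford_parts (iota' := iota)) //.
have h := fparts_sd (clifford_frame hQ) j iota (B j / Q j); rewrite hj in h.
apply: (@scalerI _ _ 2); first by rewrite pnatr_eq0.
apply: etrans (esym h) _.
have e : coad Q j (ad Q j (B j / Q j)) = coad Q j (B j) + coad Q j (B j).
  rewrite coad_ad // clifford_inv // /coad scaleNr -opprD -scalerDr half_double opprB.
  rewrite !mulrN mulNr !mulrA -[Q j * B j * _ * _]mulrA clifford_sqr //.
  by rewrite mulrN1 opprK addrC.
apply: (etrans (congr1 (fparts (d Q) (s Q) iota) e)).
by rewrite linearD [RHS]scaler_nat mulr2n.
Qed.

Lemma metricE (eta : 'M[R]_n.+1) Q (Y : system) :
  \sum_i \sum_j eta i j *: commutator (Y j) (Q i)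
    = (- 2 : R) *: \sum_i \sum_j eta i j *: s Q i (Y j).
Proof.
rewrite scaler_sumr; apply: eq_bigr => i _; rewrite scaler_sumr.
apply: eq_bigr => j _; rewrite /= /coad !scalerA [- 2 * _]mulrC -mulrA mulrNN.
by rewrite divff ?mulr1 // pnatr_eq0.
Qed.

Lemma Pi_metricE (eta : 'M[R]_n.+1) Q B X : clifford Q -> fixed_part (d Q) (s Q) X = 0 ->
  \sum_i \sum_j eta i j *: s Q i (d Q j X) = \sum_i \sum_j eta i j *: s Q i (B j) ->
  (forall Z, fixed_part (d Q) (s Q) Z = 0 ->
    \sum_i \sum_j eta i j *: s Q i (d Q j Z) = 0 -> Z = 0) ->
  Pi_metric eta Q B = X.
Proof.
move=> hQ hX hM inj.
have ME Z : M_metric eta Q Z = (- 2 : R) *: \sum_i \sum_j eta i j *: s Q i (d Q j Z).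
  exact: (metricE eta Q (fun j => d Q j Z)).
apply: pinv_eq; first exact/tangentE.
  by rewrite ME hM -metricE.
move=> Z Z' /(tangentE _ hQ) hZ /(tangentE _ hQ) hZ'; rewrite !ME => h.
apply/eqP; rewrite -subr_eq0; apply/eqP/inj.
  by rewrite linearB /= hZ hZ' subrr.
have {}h : \sum_i \sum_j eta i j *: s Q i (d Q j Z)
    = \sum_i \sum_j eta i j *: s Q i (d Q j Z').
  by apply: scalerI h; rewrite oppr_eq0 pnatr_eq0.
rewrite -[RHS](subrr (\sum_i \sum_j eta i j *: s Q i (d Q j Z'))) -[X in _ = X - _]h -sumrB.
apply: eq_bigr => i _; rewrite -sumrB; apply: eq_bigr => j _.
by rewrite (linearB (d Q j)) (linearB (s Q i)) scalerBr.
Qed.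

Lemma Pi_connection (k : 'I_n.+1) omega : connection_type F k omega ->
  connection_map F F (@clifford R A n.+1) 0 d s (Pi F omega).
Proof.
have geo := clifford_geometry hF n.
have metric eta : positive_definite eta ->
    connection_map F F (@clifford R A n.+1) 0 d s (Pi_metric eta).
  by move=> heta; apply: (metric_connection hF hF geo heta) => Q B X; exact: Pi_metricE.
case: omega => [w|eta|eta] /=.
- move=> hw; apply: (projection_connection hF hF geo hw) => Q B hQ; exact: Pi_coefE.
- exact: metric.
- move=> [heta hcvg _]; apply: (limit_connection hF geo (pis := fun m => Pi_metric (eta m))).
    by move=> m; exact: metric.
  move=> Q B hQ; have [X hX] := hcvg Q B hQ.
  by rewrite /= (flimE hF hX).
Qed.

End CliffordConnections.

(** * Floating Clifford systems *)

Section FloatingSystems.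
Variables (R : realType) (A : unitAlgType R) (n : nat).
Implicit Type Q : 'I_n.+1 -> A.

(** This form of the definition has no distinguished index, and it is bilinear in
    the system and its inverse; the latter makes it stable under rotations. *)
Lemma floating_cliffordP Q : floating_clifford Q <->
  (forall i, Q i \is a GRing.unit) /\
  (forall i j, Q i / Q j + Q j / Q i = 2 * (i == j)%:R).
Proof.
split=> [[u0 hP]|[uQ hQ]]; last first.
  split=> // i j; pose a := Q (lift ord0 i); pose b := Q (lift ord0 j).
  have h : b / Q ord0 = - (Q ord0 / b).
    by apply/eqP; rewrite -addr_eq0 hQ mulr0.
  have h' : a / Q ord0 = - (Q ord0 / a).
    by apply/eqP; rewrite -addr_eq0 hQ mulr0.
  rewrite -/a -/b {1}h [X in _ + _ * X]h' !mulrN !mulrA !mulrVK // -opprD hQ.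
  by rewrite (inj_eq lift_inj) mulNr.
set P := fun i => _ in hP.
have QE i : Q (lift ord0 i) = P i * Q ord0 by rewrite /P mulrVK.
move: P hP QE => P hP QE; have uP i : P i \is a GRing.unit := clifford_unit hP i.
split=> [i|i j]; first by case: (unliftP ord0 i) => [j|] ->; rewrite ?QE ?unitrMr.
have h0 k : Q (lift ord0 k) / Q ord0 + Q ord0 / Q (lift ord0 k) = 0.
  by rewrite QE mulrK // invrM // mulrA divrr // mul1r clifford_inv // subrr.
case: (unliftP ord0 i) => [i'|] ->; case: (unliftP ord0 j) => [j'|] ->.
- rewrite !QE !invrM // !mulrA !mulrK // (clifford_inv hP i') (clifford_inv hP j').
  by rewrite !mulrN -opprD hP (inj_eq lift_inj) mulNr opprK.
- by rewrite h0 mulr0.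
- by rewrite addrC h0 mulr0.
- by rewrite eqxx mulr1 divrr.
Qed.

Section Facts.
Variable Q : 'I_n.+1 -> A.
Hypothesis hQ : floating_clifford Q.

Lemma floating_unit i : Q i \is a GRing.unit.
Proof. by have /floating_cliffordP[] := hQ. Qed.

Lemma floating_relation i j : Q i / Q j + Q j / Q i = 2 * (i == j)%:R.
Proof. by have /floating_cliffordP[] := hQ. Qed.

Lemma floating_anti i j : i != j -> Q i / Q j = - (Q j / Q i).
Proof.
by move=> hij; apply/eqP; rewrite -addr_eq0 floating_relation (negbTE hij) mulr0.
Qed.

Lemma floating_anti_left i j : i != j -> (Q i)^-1 * Q j = - ((Q j)^-1 * Q i).
Proof.
move=> hij; have ui := floating_unit i; have uj := floating_unit j.
apply: (mulrI ui); rewrite mulrA divrr // mul1r mulrN mulrA floating_anti //.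
by rewrite mulNr opprK mulrVK.
Qed.

Lemma floating_relation_left i j :
  (Q i)^-1 * Q j + (Q j)^-1 * Q i = 2 * (i == j)%:R.
Proof.
have [<-|hij] := eqVneq i j; first by rewrite mulVr ?floating_unit // mulr1.
by rewrite floating_anti_left // addNr mulr0.
Qed.

End Facts.

(** The relations for [Q_i Q_j^-1] and for [Q_i^-1 Q_j] are bilinear, so both survive
    the rotation; at equal indices they make the rotated inverses two-sided
    inverses. *)
Lemma floating_rotate (U : 'M[R]_n.+1) Q : U *m U^T = 1%:M -> floating_clifford Q ->
  floating_clifford (rotate U Q) /\
  forall a, (rotate U Q a)^-1 = rotate U (fun j => (Q j)^-1) a.
Proof.
move=> hU hQ; pose Qi j := (Q j)^-1.
have h1 := rotated_relation hU (floating_relation hQ).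
have h2 := rotated_relation hU (floating_relation_left hQ).
have e1 a : rotate U Q a * rotate U Qi a = 1.
  by apply: double_inj; rewrite h1 eqxx mulr1.
have e2 a : rotate U Qi a * rotate U Q a = 1.
  by apply: double_inj; rewrite h2 eqxx mulr1.
have uQ a : rotate U Q a \is a GRing.unit by apply/unitrP; exists (rotate U Qi a).
have eI a : (rotate U Q a)^-1 = rotate U Qi a.
  by apply: (mulrI (uQ a)); rewrite divrr // e1.
by split=> //; apply/floating_cliffordP; split=> // i j; rewrite !eI h1.
Qed.

End FloatingSystems.

Section FloatingGeometry.
Variables (R : realType) (A : unitAlgType R) (F : nat -> set A).
Hypothesis hF : convenient F.
Variable n : nat.
Local Notation system := ('I_n.+1 -> A).
Local Notation FF := (doubled_filtration F).
Let hFF : convenient FF := doubled_convenient hF.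
Implicit Type Q : system.

Definition shift Q j (Z : doubled A) : A := Z.1 * Q j + Q j * (Z.2 : A).
Definition coshift Q j (Y : A) : doubled A :=
  doubled_pair (Y / Q j) ((Q j)^-1 * Y).

Lemma shift_is_linear Q j : linear (shift Q j).
Proof.
move=> a Z W; rewrite /shift /= mulrDl mulrDr -scalerAl -scalerAr.
by rewrite addrACA -scalerDr.
Qed.

HB.instance Definition _ Q j :=
  GRing.isLinear.Build R (doubled A) A *:%R (shift Q j) (@shift_is_linear Q j).

Lemma coshift_is_linear Q j : linear (coshift Q j).
Proof.
move=> a X Y; congr pair; rewrite /=; first by rewrite mulrDl -scalerAl.
by rewrite [LHS]mulrDr -scalerAr.
Qed.

HB.instance Definition _ Q j :=
  GRing.isLinear.Build R A (doubled A) *:%R (coshift Q j) (@coshift_is_linear Q j).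

Let d Q j : {linear doubled A -> A} := shift Q j.
Let s Q j : {linear A -> doubled A} := coshift Q j.

Lemma shift_coshift Q j Y : floating_clifford Q -> shift Q j (coshift Q j Y) = Y + Y.
Proof.
by move=> hQ; rewrite /shift /= mulrVK ?floating_unit // mulVKr ?floating_unit.
Qed.

Lemma floating_reflection Q j Z : floating_clifford Q ->
  reflection (d Q) (s Q) j Z
    = doubled_pair (- (Q j * (Z.2 : A) / Q j)) (- ((Q j)^-1 * Z.1 * Q j)).
Proof.
move=> hQ; case: Z => X Y; congr pair; rewrite /=.
  by rewrite mulrDl mulrK ?floating_unit // opprD addNKr.
rewrite [X in Y - X]mulrDr mulKr ?floating_unit // mulrA opprD.
by rewrite [LHS]addrC addrNK.
Qed.

Lemma floating_frame Q : floating_clifford Q -> frame (d Q) (s Q).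
Proof.
move=> hQ; split=> [j Y|j X|i j X] /=.
- by rewrite shift_coshift // linearD.
- by rewrite shift_coshift.
- rewrite !floating_reflection //; have [->//|hij] := eqVneq i j.
  congr pair; rewrite /= !(mulrN, mulNr) !opprK !mulrA.
    rewrite (floating_anti hQ hij) !mulNr -!mulrA [Q j / Q i](floating_anti hQ) 1?eq_sym //.
    by rewrite !mulrN opprK.
  rewrite (floating_anti_left hQ hij) !mulNr -!mulrA.
  by rewrite [_^-1 * Q i](floating_anti_left hQ) 1?eq_sym // !mulrN opprK.
Qed.

Lemma doubled_exponential_near (X : doubled A) t : (0 < t)%N -> FF t X ->
  let Z := fexp FF X in
  [/\ F t (Z.1 - 1), F t ((Z.2 : A) - 1), F t.+1 (Z.1 - 1 - X.1)
    & F t.+1 ((Z.2 : A) - 1 - (X.2 : A))].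
Proof.
move=> t0 hX Z; have [h1 h2] := exponential_approx hFF t0 hX.
have hle x : F t.+1 x -> F t x by exact: (filt_le hF (leqnSn t)).
case: hX => x1 x2; split=> //.
  by rewrite -[_ - 1](subrK X.1); apply: (filtD hF) => //; exact: hle.
by rewrite -[_ - 1](subrK (X.2 : A)); apply: (filtD hF) => //; exact: hle.
Qed.

(** [S] intertwines the two Clifford systems [Q_j Q_0^-1] and [Q'_j Q'_0^-1], and [V]
    is then determined by the index 0. *)
Lemma floating_rigid Q Q' t : (0 < t)%N -> floating_clifford Q -> floating_clifford Q' ->
  (forall j, F t (Q' j - Q j)) ->
  exists S V : A, [/\ F t (S - 1), F t (V - 1) & forall j, Q' j = S * Q j * V].
Proof.
move=> t0 [u0 hP] [u0' hP'] hQQ'.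
set P := fun i => _ in hP; set P' := fun i => _ in hP'.
pose S := intertwiner P P'.
have hS : F t (S - 1).
  apply: intertwiner_near => // i; apply: (filt_mulB hF) => //.
  exact: (filt_invB hF).
have uS : S \is a GRing.unit by apply/(filt_unit hF)/(filt_le hF t0).
pose V := (Q ord0)^-1 * S^-1 * Q' ord0.
have h0 : S * Q ord0 * V = Q' ord0.
  by rewrite /V !mulrA mulrK // divrr // mul1r.
exists S, V; split=> // [|j].
  have -> : V - 1 = (Q ord0)^-1 * S^-1 * ((Q' ord0 - Q ord0) - (S - 1) * Q ord0).
    rewrite mulrBl mul1r opprB addrA subrK mulrBr -/V mulrA mulrVK // mulVr //.
  apply/(filtMl hF)/(filtB hF) => //; exact: (filtMr hF).
case: (unliftP ord0 j) => [i|] -> //.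
have QE : Q (lift ord0 i) = P i * Q ord0 by rewrite /P mulrVK.
have QE' : Q' (lift ord0 i) = P' i * Q' ord0 by rewrite /P' mulrVK.
have : P' i * S = S * P i := intertwinerP hP hP' i.
rewrite QE QE' -h0; move: (P i) (P' i) (S) (V) => p p' S' V' h.
by rewrite !mulrA h.
Qed.

(** With [S] and [V] as in [floating_rigid], the displacement [S Q V - Q] differs from
    the infinitesimal one by the product [(S - 1) Q (V - 1)] of level [2 t]. *)
Lemma floating_geometry :
  geometry F FF (@floating_clifford R A n) 1 d s (fun X Q => fAd (fexp FF X) Q).
Proof.
split.
- exact: floating_frame.
- by move=> Q j i X [h1 h2]; apply: (filtD hF); [exact: (filtMr hF)|exact: (filtMl hF)].
- by move=> Q j i X hX; split; [exact: (filtMr hF)|exact: (filtMl hF)].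
- move=> Q Q' t j i X _ _ hQQ' [h1 h2].
  have -> : d Q j X - d Q' j X = X.1 * (Q j - Q' j) + (Q j - Q' j) * (X.2 : A).
    by rewrite /= /shift mulrBr mulrBl opprD addrACA.
  apply: (filtD hF); first by rewrite addnC; exact: (filtration_mul hF).
  exact: (filtration_mul hF).
- move=> Q Q' t j i X hQ hQ' hQQ' hX.
  have hI : F t ((Q j)^-1 - (Q' j)^-1) by apply: (filt_invB hF) => //; exact: floating_unit.
  split; rewrite /=.
    by rewrite -mulrBr addnC; exact: (filtration_mul hF).
  by rewrite -[X in F _ X]mulrBl; exact: (filtration_mul hF).
- move=> U Q hU hQ; have [hQ' hI] := floating_rotate hU hQ; split=> // [a Z|a Y].
    rewrite /= /shift /rotate mulr_sumr mulr_suml -big_split; apply: eq_bigr => j _.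
    by rewrite -scalerAl -scalerAr scalerDr.
  rewrite /= /coshift hI /rotate mulr_sumr mulr_suml.
  apply: injective_projections.
    rewrite (big_morph (fun Z : doubled A => Z.1) (id1 := 0) (op1 := +%R)) //=.
    by apply: eq_bigr => j _; rewrite -scalerAr.
  rewrite (big_morph (fun Z : doubled A => (Z.2 : A)) (id1 := 0) (op1 := +%R)) //=.
  by apply: eq_bigr => j _; rewrite -scalerAl.
- move=> Q j hQ; congr pair; rewrite ?divrr ?mulVr //; exact: floating_unit.
- move=> Q Q' t t0 hQ hQ' hQQ'.
  have [S [V [hS hV e]]] := floating_rigid t0 hQ hQ' hQQ'.
  exists (doubled_pair (S - 1) (V - 1)); split=> // j.
  have -> : Q' j - Q j - d Q j (doubled_pair (S - 1) (V - 1))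
      = (S - 1) * Q j * (V - 1).
    have -> : (S - 1) * Q j * (V - 1) = S * Q j * V - Q j * V - (S * Q j - Q j).
      by rewrite mulrBr mulr1 mulrBl mul1r mulrBl.
    rewrite /= /shift /= e mulrBl mul1r mulrBr mulr1 opprD addrA addrAC.
    by congr (_ - _); rewrite opprB addrA subrK.
  apply: (filt_le hF _ (filtration_mul hF (filtMr hF _ hS) hV)).
  by rewrite -addn1 leq_add2l.
- move=> Q X hQ hX; have [z1 z2 _ _] := doubled_exponential_near (ltn0Sn 0) hX.
  have u1 := filt_unit hF z1; have u2 := filt_unit hF z2.
  have uQ := floating_unit hQ.
  apply/floating_cliffordP; split=> [i|i j]; rewrite /fAd; first by rewrite !unitrMr.
  rewrite !invrM ?unitrMr // !mulrA !mulrK //.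
  rewrite -[_ * Q i / Q j]mulrA -[_ * Q j / Q i]mulrA -mulrDl -mulrDr floating_relation //.
  by case: (i == j); rewrite ?mulr0 ?mul0r // !mulr1 mulr_natr mulrnAl divrr.
- move=> Q X t t0 hQ hX j; have [z1 z2 r1 r2] := doubled_exponential_near t0 hX.
  set Z := fexp FF X in z1 z2 r1 r2 *.
  have -> : fAd Z Q j - Q j - d Q j X = (Z.1 - 1) * Q j * ((Z.2 : A) - 1)
      + ((Z.1 - 1 - X.1) * Q j + Q j * ((Z.2 : A) - 1 - (X.2 : A))).
    rewrite /fAd /= /shift [(Z.1 - 1 - _) * _]mulrBl [Q j * (_ - _ - _)]mulrBr addrACA -opprD addrA.
    congr (_ - _); rewrite [_ * ((Z.2 : A) - 1)]mulrBr mulr1 addrA subrK.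
    by rewrite [(Z.1 - 1) * _]mulrBl mul1r mulrBl [Q j * (_ - 1)]mulrBr mulr1 addrA subrK.
  apply: (filtD hF).
    apply: (filt_le hF _ (filtration_mul hF (filtMr hF _ z1) z2)).
    by rewrite -addn1 leq_add2l.
  by apply: (filtD hF); [exact: (filtMr hF)|exact: (filtMl hF)].
- move=> Qs Q hQs hQ; have uQs m i := floating_unit (hQs m) i.
  have uQ i : Q i \is a GRing.unit.
    have -> : Q i = Qs 0%N i * (1 - (Qs 0%N i)^-1 * (Qs 0%N i - Q i)).
      by rewrite mulrBr mulr1 mulrA divrr // mul1r opprB addrC subrK.
    rewrite unitrMr //; apply: (filt_unit hF); rewrite addrAC subrr add0r.
    by apply/(filtN hF)/(filtMl hF)/hQ.
  apply/floating_cliffordP; split=> // i j; apply: (filt_eq hF) => m.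
  rewrite -(floating_relation (hQs m) i j).
  apply: (filt_le hF (leqnSn m)); apply: (filt_sym hF).
  by rewrite opprD addrACA; apply: (filtD hF); apply: (filt_mulB hF);
    rewrite ?(filt_invB hF) //; try exact: hQ; apply: (filt_invB hF) => //; exact: hQ.
Qed.

End FloatingGeometry.

(** * Connections at a floating Clifford system *)
Section ChangeOfBase.
Variables (R : realFieldType) (E : lmodType R) (n : nat).
Variables (c c' : 'I_n -> {linear E -> E}) (k : 'I_n).
Hypothesis hc : commuting_involutions c.
Hypothesis hc' : forall i X, c' i X = c k (c i X).
Local Notation parts c iota X := (eigenparts c iota (enum 'I_n) X).

Lemma quotient_eigen (mu : {ffun 'I_n -> bool}) i X :
  c' i (parts c mu X) = (-1) ^+ (mu i (+) mu k) *: parts c mu X.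
Proof.
rewrite hc' (parts_eigen hc) [c k (_ *: _)]linearZ /= (parts_eigen hc) scalerA.
by rewrite signr_addb.
Qed.

(** The involutions [c i \o c k] cannot distinguish a sign pattern from its
    complement.  As [iota j] holds and [X] is odd under [c j], the part of [X] at
    the complement of [iota] vanishes. *)
Lemma quotient_parts (iota : {ffun 'I_n -> bool}) j X : c j X = - X -> iota j ->
  parts c' (fun i => iota i (+) iota k) X = parts c iota X.
Proof.
move=> hX hj; rewrite -[X in LHS](parts_sum c) linear_sum (bigD1 iota) //=.
rewrite (eigenparts_id (kappa := fun i => iota i (+) iota k)); last first.
  by move=> i; exact: quotient_eigen.
have -> : all (fun i => iota i (+) iota k == iota i (+) iota k) (enum 'I_n).
  by apply/allP => i _; rewrite eqxx.
rewrite scale1r big1 ?addr0 // => mu hmu.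
rewrite (eigenparts_id (kappa := fun i => mu i (+) mu k)); last first.
  by move=> i; exact: quotient_eigen.
have [hall|] := boolP (all _ _); last by rewrite scale0r.
rewrite scale1r; apply: (parts_odd hc hX); apply/negP => hmj.
case/eqP: hmu; apply/ffunP => i.
have /allP h := hall; have := h j; have := h i; rewrite !mem_enum hj hmj.
by move=> /(_ isT) + /(_ isT); case: (iota i) (mu i) (iota k) (mu k) => [] [] [] [].
Qed.

Lemma quotient_fixed X :
  parts c' (fun=> false) (eigenpart (c k) false X) = parts c [ffun=> false] X.
Proof.
rewrite -[X in LHS](parts_sum c) -[X in RHS](parts_sum c) !linear_sum.
apply: eq_bigr => mu _ /=.
rewrite (eigenpart_id (parts_eigen hc k mu X)) linearZ /=.
rewrite (eigenparts_id (kappa := fun i => mu i (+) mu k)); last first.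
  by move=> i; exact: quotient_eigen.
rewrite (parts_parts hc) scalerA -natrM mulnb; congr (_%:R *: _); congr nat_of_bool.
apply/andP/eqP => [[/eqP hk /allP h]|<-]; last first.
  by split; [|apply/allP => i _]; rewrite !ffunE.
apply/ffunP => i; rewrite ffunE; have := h i; rewrite mem_enum -hk addbF.
by move=> /(_ isT)/eqP.
Qed.

End ChangeOfBase.

Section FloatingConnections.
Variables (R : realType) (A : unitAlgType R) (F : nat -> set A).
Hypothesis hF : convenient F.
Variables (n : nat) (k : 'I_n.+1).
Local Notation system := ('I_n.+1 -> A).
Local Notation FF := (doubled_filtration F).
Let d (Q : system) j : {linear doubled A -> A} := shift Q j.
Let s (Q : system) j : {linear A -> doubled A} := coshift Q j.
Implicit Types Q B : system.

Let c' Q i : {linear doubled A -> doubled A} :=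
  (reflection (d Q) (s Q) k \o reflection (d Q) (s Q) i).

Lemma quotient_parts_pair Q (iota : 'I_n.+1 -> bool) (Z : doubled A) :
  floating_clifford Q ->
  eigenparts (c' Q) iota (enum 'I_n.+1) Z =
    doubled_pair (parts iota (fun i => Q i / Q k) Z.1)
                 (parts iota (fun i => (Q k)^-1 * Q i) (Z.2 : A)).
Proof.
move=> hQ; have uQ := floating_unit hQ.
have hc i X : c' Q i X = doubled_pair ((Q i / Q k)^-1 * X.1 * (Q i / Q k))
    (((Q k)^-1 * Q i)^-1 * (X.2 : A) * ((Q k)^-1 * Q i)).
  have [_ _ hcomm] := floating_frame hQ.
  have fr j Y := floating_reflection j Y hQ.
  have cE : c' Q i X = reflection (d Q) (s Q) k (reflection (d Q) (s Q) i X) by [].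
  have e1 : (c' Q i X).1 = (Q i / Q k)^-1 * X.1 * (Q i / Q k).
    by rewrite cE !fr /= invrM ?unitrV // invrK mulrN mulNr opprK !mulrA.
  have e2 : ((c' Q i X).2 : A) = ((Q k)^-1 * Q i)^-1 * (X.2 : A) * ((Q k)^-1 * Q i).
    by rewrite cE hcomm !fr /= invrM ?unitrV // invrK mulrN mulNr opprK !mulrA.
  by rewrite -e1 -e2; case: (c' Q i X).
rewrite /parts /eigenparts; elim: (enum _) Z => [[]//|j r IH] Z /=.
rewrite IH /eigenpart hc /part; case: (iota j) => //.
Qed.

(** The first component of the fixed part is half the element whose vanishing defines
    the tangent space; the second component is determined by the first, since the
    fixed part is invariant under the reflection [k]. *)
Lemma ftangentE Q Z : floating_clifford Q ->
  ftangent k Q Z <-> fixed_part (d Q) (s Q) Z = 0.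
Proof.
move=> hQ; have hf := floating_frame hQ; have hc := frame_involutions hf.
have uQ := floating_unit hQ.
pose W := fixed_part (d Q) (s Q) Z.
have W2 : (W.2 : A) = - ((Q k)^-1 * W.1 * Q k).
  have h : reflection (d Q) (s Q) k W = W.
    by rewrite /reflection /W d_fixed_part // linear0 subr0.
  rewrite floating_reflection // in h.
  exact: (esym (congr1 (fun Y : doubled A => (Y.2 : A)) h)).
have W1 : W.1 = 2^-1 *: parts (fun=> false) (fun i => Q i / Q k)
    (Z.1 - Q k * (Z.2 : A) / Q k).
  rewrite /W /fixed_part /fparts -(quotient_fixed (c' := c' Q) (k := k) hc) //.
  have fr := floating_reflection k Z hQ; cbv beta in fr.
  rewrite /eigenpart [X in _ *: (_ + X)]fr; set Y := Z + _.
  have -> : eigenparts (c' Q) (fun=> false) (enum 'I_n.+1) (2^-1 *: Y)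
      = 2^-1 *: eigenparts (c' Q) (fun=> false) (enum 'I_n.+1) Y by rewrite linearZ.
  by rewrite quotient_parts_pair.
rewrite /ftangent /= -/W; split=> [h|h].
  have W10 : W.1 = 0 by rewrite W1 h scaler0.
  move: W2; rewrite W10 mulr0 mul0r oppr0 => W20.
  by rewrite [LHS]surjective_pairing W10 W20.
by apply: (@scalerI _ _ 2^-1); [rewrite invr_eq0 pnatr_eq0|rewrite -W1 h scaler0].
Qed.

Lemma fPi_coefE w Q B : floating_clifford Q -> weights w ->
  fPi_coef k w Q B = projection (d Q) (s Q) w B.
Proof.
move=> hQ [w0 _]; have hf := floating_frame hQ; have hc := frame_involutions hf.
have h j (iota : {ffun 'I_n.+1 -> bool}) :
    w j iota *: fparts (d Q) (s Q) iota (s Q j (B j)) =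
    doubled_pair
      (w j iota *: parts (fun i => iota i (+) iota k) (fun i => Q i / Q k) (B j / Q j))
      (w j iota *: parts (fun i => iota i (+) iota k)
         (fun i => (Q k)^-1 * Q i) ((Q j)^-1 * B j)).
  case hj: (iota j); last by rewrite w0 // !scale0r.
  rewrite /fparts -(quotient_parts (c' := c' Q) (k := k) hc _ (j := j)) //.
    by rewrite quotient_parts_pair.
  exact: reflection_s.
rewrite /projection; under [in RHS]eq_bigr do under eq_bigr do rewrite h.
apply: injective_projections.
  rewrite /= (big_morph (fun Z : doubled A => Z.1) (id1 := 0) (op1 := +%R)) //=.
  congr (_ *: _); apply: eq_bigr => j _.
  by rewrite (big_morph (fun Z : doubled A => Z.1) (id1 := 0) (op1 := +%R)).
rewrite /= (big_morph (fun Z : doubled A => (Z.2 : A)) (id1 := 0) (op1 := +%R)) //=.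
congr (_ *: _); apply: eq_bigr => j _.
by rewrite (big_morph (fun Z : doubled A => (Z.2 : A)) (id1 := 0) (op1 := +%R)).
Qed.

Lemma fPi_metricE (eta : 'M[R]_n.+1) Q B X :
  floating_clifford Q -> fixed_part (d Q) (s Q) X = 0 ->
  \sum_i \sum_j eta i j *: s Q i (d Q j X) = \sum_i \sum_j eta i j *: s Q i (B j) ->
  (forall Z, fixed_part (d Q) (s Q) Z = 0 ->
    \sum_i \sum_j eta i j *: s Q i (d Q j Z) = 0 -> Z = 0) ->
  fPi_metric k eta Q B = X.
Proof.
move=> hQ hX hM inj; apply: pinv_eq; first exact/ftangentE.
  exact: hM.
move=> Z Z' /(ftangentE _ hQ) hZ /(ftangentE _ hQ) hZ' h.
apply/eqP; rewrite -subr_eq0; apply/eqP/inj.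
  by rewrite linearB /= hZ hZ' subrr.
have {}h : \sum_i \sum_j eta i j *: s Q i (d Q j Z)
    = \sum_i \sum_j eta i j *: s Q i (d Q j Z') by exact: h.
rewrite -[RHS](subrr (\sum_i \sum_j eta i j *: s Q i (d Q j Z'))).
rewrite -[X in _ = X - _]h -sumrB.
apply: eq_bigr => i _; rewrite -sumrB; apply: eq_bigr => j _.
by rewrite (linearB (d Q j)) (linearB (s Q i)) scalerBr.
Qed.

Lemma fPi_connection omega : connection_type F k omega ->
  connection_map F FF (@floating_clifford R A n) 1 d s (fPi F k omega).
Proof.
have hFF := doubled_convenient hF; have geo := floating_geometry hF n.
have metric eta : positive_definite eta ->
    connection_map F FF (@floating_clifford R A n) 1 d s (fPi_metric k eta).
  by move=> heta; apply: (metric_connection hF hFF geo heta) => Q B X; exact: fPi_metricE.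
case: omega => [w|eta|eta] /=.
- by move=> hw; apply: (projection_connection hF hFF geo hw) => Q B hQ; exact: fPi_coefE.
- exact: metric.
- move=> [heta _ hcvg].
  apply: (limit_connection hFF geo (pis := fun m => fPi_metric k (eta m))).
    by move=> m; exact: metric.
  move=> Q B hQ; have [X hX] := hcvg Q B hQ.
  by rewrite /= (flimE hFF hX).
Qed.

End FloatingConnections.

Theorem theorem5p3 (R : realType) (A : unitAlgType R) (F : nat -> set A)
    (hF : convenient F) (n : nat) (k : 'I_n.+1) (omega : connection R n.+1)
    (homega : connection_type F k omega) (B Q : 'I_n.+1 -> A)
    (hBQ : forall j, F 1%N (B j - Q j)) :
  (clifford Q ->
   exists Qlim : 'I_n.+1 -> A,
     [/\ forall j, converges F (fun m => iter m (Step F omega B) Q j) (Qlim j),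
         forall m j, F m.+1 (iter m (Step F omega B) Q j - Qlim j),
         clifford Qlim,
         Pi F omega Qlim B = 0 /\ (forall j, F 1%N (B j - Qlim j))
       & forall Q' : 'I_n.+1 -> A, clifford Q' -> Pi F omega Q' B = 0 ->
           (forall j, F 1%N (B j - Q' j)) -> Q' = Qlim])
  /\
  (floating_clifford Q ->
   exists Qlim : 'I_n.+1 -> A,
     [/\ forall j,
           converges F (fun m => iter m (fStep F k omega B) Q j) (Qlim j),
         forall m j, F m.+1 (iter m (fStep F k omega B) Q j - Qlim j),
         floating_clifford Qlim,
         fPi F k omega Qlim B = (2^-1 : R) *: 1
           /\ (forall j, F 1%N (B j - Qlim j))
       & forall Q' : 'I_n.+1 -> A, floating_clifford Q' ->
           fPi F k omega Q' B = (2^-1 : R) *: 1 ->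
           (forall j, F 1%N (B j - Q' j)) -> Q' = Qlim]).
Proof.
split=> hQ.
  have := iteration_limit hF hF (clifford_geometry hF n) (Pi_connection hF homega) hQ hBQ.
  by rewrite scaler0.
exact: (iteration_limit hF (doubled_convenient hF) (floating_geometry hF n)
  (fPi_connection hF homega) hQ hBQ).
Qed.
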